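(* Suppose $f:(\mathbb{C}^n,0)\to(\mathbb{C},0)$ is a complex analytic function germ. Then $f\in J(f)_{S,f}$, that is, $f$ belongs to the Lipschitz saturation of its Jacobian ideal relative to $f$.
   Context: $J(f)\subset\mathcal{O}_n=\mathcal{O}_{\mathbb{C}^n,0}$ is the ideal generated by $\partial f/\partial z_1,\dots,\partial f/\partial z_n$. Let $p_1,p_2$ be the projections of $\mathbb{C}^n\times\mathbb{C}^n$ to its factors. For $h\in\mathcal{O}_n$, $h_D=(h\circ p_1,h\circ p_2)\in\mathcal{O}^2_{\mathbb{C}^n\times\mathbb{C}^n,(0,0)}$. For an ideal $I\subset\mathcal{O}_n$, $I_D$ is the submodule of $\mathcal{O}^2_{\mathbb{C}^n\times\mathbb{C}^n,(0,0)}$ generated by all $h_D$, $h\in I$. Let $\mathbb{C}^n\times_f\mathbb{C}^n$ be the subspace of $\mathbb{C}^n\times\mathbb{C}^n$ defined by $f\circ p_1=f\circ p_2$. Integral closure: for a submodule $M\subset\mathcal{O}_{X,x}^p$, $h\in\overline{M}$ if $h\circ\phi\in(\phi^*M)\mathcal{O}_1$ for every analytic $\phi:(\mathbb{C},0)\to(X,x)$, with $\mathcal{O}_1=\mathcal{O}_{\mathbb{C},0}$. Relative Lipschitz saturation: $h\in I_{S,f}$ if $h_D$ is in the integral closure of $I_D$ when both are restricted to $\mathbb{C}^n\times_f\mathbb{C}^n$ at $(0,0)$; equivalently, for every analytic curve germ $\Phi=(\phi_1,\phi_2):(\mathbb{C},0)\to(\mathbb{C}^n\times\mathbb{C}^n,(0,0))$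 with $f\circ\phi_1=f\circ\phi_2$, $h_D\circ\Phi$ lies in the submodule $\Phi^*(I_D)$ of $\mathcal{O}_1^2$ generated by the pullbacks by $\Phi$ of elements of $I_D$. *)

(* Defs.v *)
From HB Require Import structures.
From mathcomp Require Import all_boot all_order all_algebra.
From mathcomp Require Import finmap complex.
From mathcomp Require Import boolp classical_sets reals topology normedtype.
From mathcomp Require Import derive summability.

Set Implicit Arguments.
Unset Strict Implicit.
Unset Printing Implicit Defensive.

Import Order.TTheory GRing.Theory Num.Theory numFieldNormedType.Exports.

Local Open Scope classical_set_scope.
Local Open Scope ring_scope.

(* The complex numbers over R, packaged as a numFieldType: the topology and
   the norm of MathComp-Analysis are attached to the structure, not to the bare
   type R[i]. *)
Definition Cplx (R : realType) : numFieldType := R[i]%C.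

(* The notions below are written for an abstract scalar field C, so that
   rewriting does not unfold it. They are meant for [C := Cplx R]. *)
Section AnalyticGerms.
Variable C : numFieldType.

(* Germs at 0 are represented by total functions. All the notions below depend
   only on the values near 0. *)

Definition monomial n (m : {ffun 'I_n -> nat}) (z : 'rV[C]_n) : C :=
  \prod_(i < n) z 0 i ^+ m i.

(* [f] is near 0 the sum of a power series. [totally] is the filter of large
   finite sets of multi-indices, so convergence is unconditional, hence
   absolute. The germs of these functions form O_n. *)
Definition analytic0 n (f : 'rV[C]_n -> C) : Prop :=
  exists c : {ffun 'I_n -> nat} -> C,
    \forall z \near (0 : 'rV[C]_n),
      partial_sum (fun m => c m * monomial m z) @ totally --> f z.

Definition map_germ0 n N (phi : 'rV[C]_n -> 'rV[C]_N) : Prop :=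
  phi 0 = 0 /\ forall j, analytic0 (fun t => phi t 0 j).

(* The O_n-submodule generated by a set [S] of germs with values in [W]. It is
   used with [W = C], where it is the ideal generated by [S], and with
   [W = C * C], where it is a submodule of O_n^2. *)
Definition submod_gen n (W : lmodType C) (S : set ('rV[C]_n -> W)) :
    set ('rV[C]_n -> W) :=
  [set g | exists k (a : 'I_k -> 'rV[C]_n -> C) (s : 'I_k -> 'rV[C]_n -> W),
    [/\ forall j, analytic0 (a j), forall j, S (s j) &
        \forall z \near (0 : 'rV[C]_n), g z = \sum_(j < k) a j z *: s j z]].

Definition jacobian_ideal n (f : 'rV[C]_n -> C) : set ('rV[C]_n -> C) :=
  submod_gen (range (fun i : 'I_n => 'D_(delta_mx 0 i) f)).

(* Curves are germs (C, 0) -> (X, 0), with 'rV[C]_1 for the source C. *)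
Definition integral_closure N (W : lmodType C) (X : set 'rV[C]_N)
    (M : set ('rV[C]_N -> W)) : set ('rV[C]_N -> W) :=
  [set h : 'rV[C]_N -> W | forall phi : 'rV[C]_1 -> 'rV[C]_N, map_germ0 phi ->
    (\forall t \near (0 : 'rV[C]_1), X (phi t)) ->
    submod_gen [set m \o phi | m in M] (h \o phi)].

(* C^n x C^n is 'rV[C]_(n + n), with projections lsubmx and rsubmx. *)
Definition doubled n (h : 'rV[C]_n -> C) (w : 'rV[C]_(n + n)) : C * C :=
  (h (lsubmx w), h (rsubmx w)).

Definition doubled_module n (I : set ('rV[C]_n -> C)) :
    set ('rV[C]_(n + n) -> C * C) :=
  submod_gen [set doubled h | h in I].

Definition fiber_square n (f : 'rV[C]_n -> C) : set 'rV[C]_(n + n) :=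
  [set w | f (lsubmx w) = f (rsubmx w)].

Definition rel_lipschitz_saturation n (f : 'rV[C]_n -> C)
    (I : set ('rV[C]_n -> C)) : set ('rV[C]_n -> C) :=
  [set h | analytic0 h /\
    integral_closure (fiber_square f) (doubled_module I) (doubled h)].

End AnalyticGerms.

(* Main.v *)
Require Import Defs.
From mathcomp Require Import all_boot all_order all_algebra.
From mathcomp Require Import finmap complex.
From mathcomp Require Import boolp classical_sets functions reals topology.
From mathcomp Require Import normedtype derive summability.
From mathcomp Require Import ring.

(** The statement is about one curve at a time. Let [phi = (x, y)] be a curve
    with [f o x = f o y =: g], and write [E u = t u'] for the Euler derivative
    of a germ [u] in one variable. By the chain rule, taken along either half,
    [E g = sum_j (E x_j) (D_j f o x) = sum_j (E y_j) (D_j f o y)].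

    The Euler derivative multiplies the coefficient of [t^k] by [k], so it
    preserves the order of vanishing of every germ without constant term.
    Germs in one variable are divisible by germs of smaller or equal order
    ([analytic1_divide]), so [g = c E g] and
    [E x_j - E y_j = d_j (x_j - y_j)] for some analytic [c] and [d_j]
    ([analytic1_euler]); for the first equation [g 0 = 0] is essential.

    The module [I_D] of an ideal [I] contains
    [(0, (z_j - w_j) h(w)) = z_j h_D - (z_j h)_D] for each [h] in [I]
    ([doubled_module_second]). Pulled back by [phi] and applied to
    [h = D_j f], this gives the decomposition
    [(g, g) = sum_j c (E x_j) (D_j f o x, D_j f o y)
              - sum_j c d_j (0, (x_j - y_j) (D_j f o y))],
    whose second component is [c sum_j (E y_j) (D_j f o y) = c E g = g]
    because [E x_j - d_j (x_j - y_j) = E y_j].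

    The analysis behind this is that [g] is again a convergent power series
    ([analytic1_comp]) and that the chain rule holds at all points near the
    origin ([chain_rule]). Both are interchanges of limits, and both reduce to
    Tannery's theorem, dominated convergence for sums ([tannery]). A power
    series at radius [r] is measured by the sum of the [|a_k| r^k]: this norm
    is submultiplicative, and a family of power series with summable norms has
    a power series as its sum ([power_series_family]), from which products,
    inverses of units and composites all follow. Everything is done over a
    field in which summable and absolutely bounded families are the same;
    the complex numbers are such a field ([complex_summable]). *)

Set Implicit Arguments.
Unset Strict Implicit.
Unset Printing Implicit Defensive.

Import Order.TTheory GRing.Theory Num.Theory numFieldNormedType.Exports.

Local Open Scope classical_set_scope.
Local Open Scope ring_scope.

#[local] Existing Instance totally_filter.

(** * Unconditional sums *)

Section HasSum.
Variable C : numFieldType.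
Implicit Types (I J : choiceType).

(** Convergence of the finite partial sums, in epsilon form so that sums can be
    handled by elementary estimates; [has_sumP] relates it to limits along
    [totally]. *)
Definition has_sum I (a : I -> C) (s : C) : Prop :=
  forall e, 0 < e -> exists A0 : {fset I}, forall A : {fset I},
    (A0 `<=` A)%fset -> `|s - \sum_(i <- A) a i| <= e.

(** The bound is a scalar because the norm of a [numFieldType] takes its values
    in the field itself. *)
Definition abs_bounded I (a : I -> C) (B : C) : Prop :=
  forall A : {fset I}, \sum_(i <- A) `|a i| <= B.

Lemma has_sum_cvg I (a : I -> C) (s : C) :
  has_sum a s <-> \sum_(i <- enum_fset A) a i @[A --> totally] --> s.
Proof.
split=> [h|/cvgrPdist_le h e e0].
  by apply/cvgrPdist_le => e /h [A0 hA0]; exists A0.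
by have [A0 _ hA0] := h e e0; exists A0.
Qed.

Lemma has_sumP I (a : I -> C) (s : C) :
  has_sum a s <-> partial_sum a @ totally --> s.
Proof.
rewrite has_sum_cvg (_ : partial_sum a = fun A => \sum_(i <- enum_fset A) a i) //.
by apply/funext => A; rewrite /partial_sum big_seq_fsetE.
Qed.

Lemma sum_fsetD I (A0 A : {fset I}) (a : I -> C) : (A0 `<=` A)%fset ->
  \sum_(i <- A) a i = \sum_(i <- A0) a i + \sum_(i <- (A `\` A0)%fset) a i.
Proof.
move=> /fsubsetP A0A; rewrite (big_fsetID _ (mem A0)) /=; congr (_ + _).
  congr (\sum_(i <- enum_fset _) _); apply/fsetP => i; rewrite !inE /=.
  by apply/andP/idP => [[]//|iA0]; rewrite A0A.
congr (\sum_(i <- enum_fset _) _); apply/fsetP => i; rewrite !inE /=.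
by rewrite andbC.
Qed.

Lemma ler_sum_fset I (A B : {fset I}) (b : I -> C) : (A `<=` B)%fset ->
  (forall i, 0 <= b i) -> \sum_(i <- A) b i <= \sum_(i <- B) b i.
Proof. by move=> /sum_fsetD -> b0; rewrite lerDl; apply: sumr_ge0. Qed.

Lemma has_sum_unique I (a : I -> C) s1 s2 :
  has_sum a s1 -> has_sum a s2 -> s1 = s2.
Proof.
by move=> /has_sumP h1 /has_sumP h2; apply: (cvg_unique _ h1 h2).
Qed.

Lemma has_sumD I (a b : I -> C) s t :
  has_sum a s -> has_sum b t -> has_sum (fun i => a i + b i) (s + t).
Proof.
move=> ha hb e e0; have e20 : 0 < e / 2 by rewrite divr_gt0.
have [A hA] := ha _ e20; have [B hB] := hb _ e20.
exists (A `|` B)%fset => D; rewrite fsubUset => /andP[/hA h1 /hB h2].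
rewrite big_split /= opprD addrACA [leRHS](splitr e).
by rewrite (le_trans (ler_normD _ _)) ?lerD.
Qed.

Lemma has_sumZ I (a : I -> C) s k :
  has_sum a s -> has_sum (fun i => k * a i) (k * s).
Proof.
move=> ha e e0; have k0 : 0 < `|k| + 1 by rewrite ltr_wpDl.
have [A hA] := ha (e / (`|k| + 1)) (divr_gt0 e0 k0).
exists A => D /hA; rewrite -mulr_sumr -mulrBr normrM ler_pdivlMr // => h.
by rewrite (le_trans _ h) // mulrC ler_wpM2l // lerDl.
Qed.

Lemma has_sum_sum I J (r : seq J) (a : J -> I -> C) (s : J -> C) :
  (forall j, has_sum (a j) (s j)) ->
  has_sum (fun i => \sum_(j <- r) a j i) (\sum_(j <- r) s j).
Proof.
move=> h; elim: r => [|j r IH].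
  move=> e e0; exists fset0 => A _; rewrite big_nil sub0r normrN.
  by rewrite big1 ?normr0 ?ltW // => i _; rewrite big_nil.
have := has_sumD (h j) IH; rewrite big_cons.
by congr has_sum; apply/funext => i; rewrite big_cons.
Qed.

Lemma has_sum_le I (a : I -> C) s B : has_sum a s -> abs_bounded a B ->
  `|s| <= B.
Proof.
move=> hs aB; apply/ler_addgt0Pr => e e0.
have [A /(_ A (fsubset_refl _)) h] := hs e e0.
rewrite -(subrK (\sum_(i <- A) a i) s) (le_trans (ler_normD _ _)) //.
by rewrite addrC lerD // (le_trans (ler_norm_sum _ _ _)).
Qed.

(** The Cauchy criterion: two partial sums over sets containing [A0] differ by
    at most [e], and a set disjoint from [A0] is such a difference. *)
Lemma has_sum_tail I (a : I -> C) s : has_sum a s ->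
  forall e, 0 < e -> exists A0 : {fset I}, forall A : {fset I},
    [disjoint A & A0]%fset -> `|\sum_(i <- A) a i| <= e.
Proof.
move=> h e e0; have [A0 hA0] := h _ (divr_gt0 e0 (ltr0n _ 2)).
exists A0 => A AA0; have := sum_fsetD a (fsubsetUl A0 A).
have -> : ((A0 `|` A) `\` A0 = A)%fset.
  by rewrite fsetDUl fsetDv fset0U; apply/fsetDidPl.
move/eqP; rewrite addrC -subr_eq => /eqP <-.
rewrite -(subrKA s) (le_trans (ler_normD _ _)) // [leRHS]splitr lerD //.
  by rewrite distrC hA0 // fsubsetUl.
exact: hA0.
Qed.

(** The order of [C] is partial, so it is not enough to exclude [s < 0]; the
    proof shows instead that [s] is its own norm. *)
Lemma has_sum_ge0 I (b : I -> C) s : (forall i, 0 <= b i) ->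
  has_sum b s -> 0 <= s.
Proof.
move=> b0 h; suff /eqP -> : s == `|s| by [].
rewrite -subr_eq0 -normr_le0; apply/ler_addgt0Pr => e e0; rewrite add0r.
have [A /(_ A (fsubset_refl _))] := h _ (divr_gt0 e0 (ltr0n _ 2)).
set t := \sum_(i <- _) _ => h1.
have tE : `|t| = t by rewrite ger0_norm //; apply: sumr_ge0.
rewrite -(subrKA t) (le_trans (ler_normD _ _)) // [leRHS]splitr lerD //.
by rewrite -tE (le_trans (ler_dist_dist _ _)) // distrC.
Qed.

Lemma has_sum_ge0_bounded I (b : I -> C) s : (forall i, 0 <= b i) ->
  has_sum b s -> abs_bounded b s.
Proof.
move=> b0 h A; apply/ler_addgt0Pr => e e0; have [A0 hA0] := h e e0.
rewrite (eq_bigr b); last by move=> i _; rewrite ger0_norm.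
rewrite (le_trans (ler_sum_fset (fsubsetUr A0 A) b0)) //.
have := hA0 (A0 `|` A)%fset (fsubsetUl _ _).
set t := \sum_(i <- _) _ => h1.
have t0 : 0 <= t by apply: sumr_ge0.
rewrite -lerBlDl (le_trans _ h1) // distrC real_ler_norm //.
by rewrite realB // ger0_real //; apply: has_sum_ge0 h.
Qed.

Lemma has_sum_triangle I (a : I -> C) s s' :
  has_sum a s -> has_sum (fun i => `|a i|) s' -> `|s| <= s'.
Proof.
move=> h /has_sum_ge0_bounded h'; apply: has_sum_le h _ => A.
apply: le_trans (h' _ A); last by [].
by apply: ler_sum => i _; rewrite normr_id.
Qed.

(** A finite sum over [J] is pulled back along an injection [e] whose image
    carries all of [f]. The left inverse [g] serves to form the finite set of
    preimages, and by the last clause [A'] exhausts [I] as [A] exhausts [J]. *)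
Lemma sum_reindex I J (e : I -> J) (g : J -> I) (V : zmodType) (f : J -> V)
    (A : {fset J}) : cancel e g -> (forall j, e (g j) != j -> f j = 0) ->
  exists2 A' : {fset I}, \sum_(j <- A) f j = \sum_(i <- A') f (e i) &
    forall i, e i \in A -> i \in A'.
Proof.
move=> eK f0; set A1 := [fset j in A | e (g j) == j]%fset.
exists (g @` A1)%fset; last first.
  by move=> i eiA; apply/imfsetP; exists (e i); rewrite /= ?inE ?eK ?eiA /=.
rewrite big_imfset /=; last first.
  move=> j k; rewrite !inE => /andP[_ /eqP ej] /andP[_ /eqP ek].
  by rewrite -{2}ej -{2}ek => ->.
rewrite -(@big_fset_incl _ _ _ _ A1) /=; last 2 first.
- by apply/fsubsetP => j; rewrite !inE => /andP[].
- move=> j jA; rewrite !inE jA /= => /f0 //.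
rewrite big_seq [RHS]big_seq; apply: eq_bigr => j.
by rewrite !inE /= => /andP[_ /eqP ->].
Qed.

Lemma has_sum_reindex I J (e : I -> J) (g : J -> I) (f : J -> C) s :
  cancel e g -> (forall j, e (g j) != j -> f j = 0) ->
  has_sum (f \o e) s -> has_sum f s.
Proof.
move=> eK f0 h eps /h [A0 hA0]; exists (e @` A0)%fset => A /fsubsetP A0A.
have [A' -> AA'] := sum_reindex A eK f0; apply: hA0; apply/fsubsetP => i iA0.
by apply/AA'/A0A/imfsetP; exists i.
Qed.

Lemma abs_bounded_reindex I J (e : I -> J) (g : J -> I) (f : J -> C) B :
  cancel e g -> (forall j, e (g j) != j -> f j = 0) ->
  abs_bounded (f \o e) B -> abs_bounded f B.
Proof.
move=> eK f0 h A.
have [|A' -> _] := sum_reindex (f := fun j => `|f j|) A eK; last exact: h.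
by move=> j /f0 ->; rewrite normr0.
Qed.

Lemma abs_bounded_inj I J (e : I -> J) (f : J -> C) B :
  injective e -> abs_bounded f B -> abs_bounded (f \o e) B.
Proof.
move=> e_inj h A; have := h (e @` A)%fset.
by rewrite big_imfset //= => i j _ _ /e_inj.
Qed.

Lemma has_sum_bij I J (e : I -> J) (g : J -> I) (f : J -> C) s :
  cancel e g -> cancel g e -> has_sum (f \o e) s <-> has_sum f s.
Proof.
move=> eK gK; split; first by apply: has_sum_reindex eK _ => j; rewrite gK eqxx.
rewrite (_ : has_sum f s = has_sum ((f \o e) \o g) s).
  by apply: has_sum_reindex gK _ => i; rewrite eK eqxx.
by congr has_sum; apply/funext => j /=; rewrite gK.
Qed.

Lemma has_sum_finite I (A0 : {fset I}) (a : I -> C) :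
  (forall i, i \notin A0 -> a i = 0) -> has_sum a (\sum_(i <- A0) a i).
Proof.
move=> a0 e e0; exists A0 => A A0A; rewrite (sum_fsetD a A0A).
rewrite [X in _ - (_ + X)]big1_seq ?addr0 ?subrr ?normr0 ?ltW //.
by move=> i /=; rewrite !inE => /andP[/a0].
Qed.

Lemma abs_bounded_ge0 I (a : I -> C) B : abs_bounded a B -> 0 <= B.
Proof. by move=> /(_ fset0); rewrite big_seq_fset0. Qed.

Lemma abs_bounded_le I (a b : I -> C) B : abs_bounded b B ->
  (forall i, `|a i| <= `|b i|) -> abs_bounded a B.
Proof. by move=> h ab A; apply: le_trans (h A); apply: ler_sum. Qed.

Lemma abs_boundedD I (a b : I -> C) A B : abs_bounded a A -> abs_bounded b B ->
  abs_bounded (fun i => a i + b i) (A + B).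
Proof.
move=> ha hb F; apply: le_trans (lerD (ha F) (hb F)).
by rewrite -big_split /=; apply: ler_sum => i _; apply: ler_normD.
Qed.

Lemma abs_boundedZ I (a : I -> C) B k : abs_bounded a B ->
  abs_bounded (fun i => k * a i) (`|k| * B).
Proof.
move=> h A; apply: le_trans (ler_wpM2l (normr_ge0 k) (h A)).
by rewrite mulr_sumr; apply: ler_sum => i _; rewrite normrM.
Qed.

Lemma abs_bounded_term I (a : I -> C) B i : abs_bounded a B -> `|a i| <= B.
Proof. by move=> /(_ [fset i]%fset); rewrite big_seq_fset1. Qed.

End HasSum.

(** * Absolute convergence over the complex numbers *)

Section ClosedField.
Variable K : numClosedFieldType.
(* Completeness is assumed for nonnegative families only; real and imaginary
   parts and their signs reduce everything to these. *)
Hypothesis Ksup : forall (I : choiceType) (p : I -> K) B,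
  (forall i, 0 <= p i) -> (forall A : {fset I}, \sum_(i <- A) p i <= B) ->
  exists s, has_sum p s.

(** Outside a finite set all finite sums have norm at most [1]. A finite set is
    cut into the terms where the real part is nonnegative and those where it is
    negative: on each piece the sum of the absolute values of the real parts is,
    up to sign, the real part of a finite sum, hence at most [1]. The same
    holds for imaginary parts. *)
Lemma has_sum_abs_bounded (I : choiceType) (a : I -> K) s :
  has_sum a s -> exists B, abs_bounded a B.
Proof.
move=> ha; have [A0 hA0] := has_sum_tail ha ltr01.
have half (psi : K -> K) : (forall z w, psi (z + w) = psi z + psi w) ->
    psi 0 = 0 -> (forall z, psi z \is Num.real) ->
    (forall z, `|psi z| <= `|z|) ->
    forall A : {fset I}, [disjoint A & A0]%fset ->
      \sum_(i <- A) `|psi (a i)| <= 2.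
  move=> psiD psi0 psiR psi_le A /fdisjointP AA0.
  have psi_sum (B : {fset I}) :
      \sum_(i <- B) psi (a i) = psi (\sum_(i <- B) a i).
    elim: (enum_fset B) => [|i r IH]; first by rewrite !big_nil.
    by rewrite !big_cons IH psiD.
  have le1 (B : {fset I}) : (B `<=` A)%fset ->
      `|\sum_(i <- B) psi (a i)| <= 1.
    move=> /fsubsetP BA; rewrite psi_sum (le_trans (psi_le _)) // hA0 //.
    by apply/fdisjointP => i /BA /AA0.
  rewrite (big_fsetID _ [pred i | 0 <= psi (a i)]) /= -[2]/(1 + 1) lerD //.
    rewrite big_seq (eq_bigr (fun i => psi (a i))) -?big_seq; last first.
      by move=> i; rewrite !inE => /andP[_ /ger0_norm].
    rewrite (le_trans _ (le1 [fset i in A | 0 <= psi (a i)]%fset _)) //.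
      by apply: real_ler_norm; rewrite psi_sum.
    by apply/fsubsetP => i; rewrite !inE => /andP[].
  rewrite big_seq (eq_bigr (fun i => - psi (a i))) -?big_seq; last first.
    move=> i; rewrite !inE => /andP[_]; rewrite -real_ltNge ?real0 // => /ltW.
    by move/ler0_norm.
  rewrite sumrN (le_trans _ (le1 [fset i in A | ~~ (0 <= psi (a i))]%fset _)) //.
    by rewrite -normrN; apply: real_ler_norm; rewrite psi_sum realN.
  by apply/fsubsetP => i; rewrite !inE => /andP[].
exists (\sum_(i <- A0) `|a i| + (2 + 2)) => A.
have a0 i : 0 <= `|a i| by [].
rewrite (le_trans (ler_sum_fset (fsubsetUr A0 A) a0)) //.
rewrite (sum_fsetD _ (fsubsetUl A0 A)) lerD2l.
set D := (_ `\` _)%fset.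
have dD : [disjoint D & A0]%fset.
  by apply/fdisjointP => i; rewrite !inE => /andP[].
have hR := half (fun z => 'Re z) (fun z w => raddfD _ z w) (raddf0 _)
  (fun z => Creal_Re z) (fun z => leif_normC_Re_Creal z) D dD.
have hI := half (fun z => 'Im z) (fun z w => raddfD _ z w) (raddf0 _)
  (fun z => Creal_Im z) _ D dD.
apply: le_trans (lerD hR (hI _)).
  rewrite -big_split /=; apply: ler_sum => i _; rewrite {1}[a i]Crect.
  by rewrite (le_trans (ler_normD _ _)) // normrM normCi mul1r.
move=> z; have := leif_normC_Re_Creal ('i * z).
by rewrite ReMil normrN normrM normCi mul1r => h; exact: h.
Qed.

(** A real family is the difference of the nonnegative families
    [|psi a| + psi a] and [|psi a|]. *)
Lemma abs_bounded_has_sum (I : choiceType) (a : I -> K) B :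
  abs_bounded a B -> exists s, has_sum a s.
Proof.
move=> aB.
have part (psi : K -> K) : (forall z, psi z \is Num.real) ->
    (forall z, `|psi z| <= `|z|) -> exists s, has_sum (fun i => psi (a i)) s.
  move=> psiR psi_le.
  have absB : forall A : {fset I}, \sum_(i <- A) `|psi (a i)| <= B.
    by move=> A; apply: le_trans (aB A); apply: ler_sum.
  have [s1 h1] := Ksup (fun i => normr_ge0 (psi (a i))) absB.
  have [|A|s2 h2] := @Ksup I (fun i => `|psi (a i)| + psi (a i)) (B + B).
  - move=> i; rewrite -lerBlDr sub0r -normrN.
    by apply: real_ler_norm; rewrite realN.
  - rewrite big_split lerD // (le_trans _ (absB A)) //.
    by apply: ler_sum => i _; apply: real_ler_norm.
  exists (s2 + -1 * s1); have := has_sumD h2 (has_sumZ (-1) h1).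
  by congr has_sum; apply/funext => i; rewrite mulN1r addrC addKr.
have [s1 h1] := part (fun z => 'Re z) (fun z => Creal_Re z)
  (fun z => leif_normC_Re_Creal z).
have [|s2 h2] := part (fun z => 'Im z) (fun z => Creal_Im z).
  move=> z; have := leif_normC_Re_Creal ('i * z).
  by rewrite ReMil normrN normrM normCi mul1r => h; exact: h.
exists (s1 + 'i * s2); have := has_sumD h1 (has_sumZ 'i h2).
by congr has_sum; apply/funext => i; rewrite -Crect.
Qed.

End ClosedField.

(** Of the properties of the complex numbers, only this one is used below. From
    right to left it is a form of completeness. *)
Definition summable_iff_abs_bounded (C : numFieldType) : Prop :=
  forall (I : choiceType) (a : I -> C),
    (exists s, has_sum a s) <-> (exists B, abs_bounded a B).

(** The partial sums increase, and their supremum is the sum. *)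
Lemma complex_has_sum_ge0 (R : realType) (I : choiceType) (p : I -> R[i]%C) B :
  (forall i, 0 <= p i) -> (forall A : {fset I}, \sum_(i <- A) p i <= B) ->
  exists s, has_sum p s.
Proof.
move=> p0 pB; pose S A := complex.Re (\sum_(i <- A) p i).
have SE (A : {fset I}) : \sum_(i <- A) p i = (S A)%:C%C.
  by rewrite RRe_real // ger0_real // sumr_ge0.
have hS : has_sup (range (fun A : {fset I} => S A)).
  split; first by exists (S fset0), fset0.
  exists (complex.Re B) => _ [A _ <-].
  by have := pB A; rewrite lecE => /andP[].
exists (sup (range (fun A : {fset I} => S A)))%:C%C => e e0.
have eE : (complex.Re e)%:C%C = e by rewrite RRe_real // gtr0_real.
have e1 : 0 < complex.Re e by move: e0; rewrite -{1}eE ltcR.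
have [_ [A0 _ <-] hA0] := sup_adherent e1 hS.
exists A0 => A A0A; rewrite SE -rmorphB -eE.
have SA : S A <= sup (range (fun A : {fset I} => S A)).
  by apply: ub_le_sup; [case: hS | exists A].
rewrite ger0_norm ?ler0c ?subr_ge0 // lecR lerBlDr -lerBlDl ltW //.
rewrite (lt_le_trans hA0) //; have := ler_sum_fset A0A p0.
by rewrite !SE lecR.
Qed.

Lemma complex_summable (R : realType) : summable_iff_abs_bounded (Cplx R).
Proof.
move=> I a; split=> [[s]|[B]].
  exact: (@has_sum_abs_bounded R[i]%C).
exact: (@abs_bounded_has_sum R[i]%C (@complex_has_sum_ge0 R)).
Qed.

(** * Dominated convergence for sums *)

Section Tannery.
Variable C : numFieldType.
Hypothesis hC : summable_iff_abs_bounded C.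

Lemma abs_bounded_tail (I : choiceType) (b : I -> C) B : abs_bounded b B ->
  forall e, 0 < e -> exists A0 : {fset I}, forall A : {fset I},
    [disjoint A & A0]%fset -> \sum_(i <- A) `|b i| <= e.
Proof.
move=> bB e e0; have nbB : abs_bounded (fun i => `|b i|) B.
  by move=> A; apply: le_trans (bB A); apply: ler_sum => i _; rewrite normr_id.
have [|s hs] := (hC (fun i => `|b i|)).2; first by exists B.
have [A0 hA0] := has_sum_tail hs e0; exists A0 => A /hA0.
by rewrite ger0_norm // sumr_ge0.
Qed.

Lemma has_sum_split_le (I : choiceType) (a : I -> C) s (A0 : {fset I}) e :
  has_sum a s ->
  (forall A : {fset I}, [disjoint A & A0]%fset -> \sum_(i <- A) `|a i| <= e) ->
  `|s| <= \sum_(i <- A0) `|a i| + e.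
Proof.
move=> h tl; apply: has_sum_le h _ => A.
have a0 i : 0 <= `|a i| by [].
rewrite (le_trans (ler_sum_fset (fsubsetUr A0 A) a0)) //.
rewrite (sum_fsetD _ (fsubsetUl A0 A)) lerD2l tl //.
by apply/fdisjointP => i; rewrite !inE => /andP[].
Qed.

(** Tannery's theorem. Outside a finite set [A0] the dominating family
    contributes an arbitrarily small amount to both sums, uniformly in [x], and
    on [A0] there are finitely many limits to wait for. *)
Lemma tannery (I : choiceType) (T : Type) (F : set_system T)
    (FF : ProperFilter F) (h : I -> T -> C) (l b : I -> C) (B : C) (S : T -> C) :
  abs_bounded b B ->
  (\forall x \near F, forall i, `|h i x| <= `|b i|) ->
  (forall i, h i x @[x --> F] --> l i) ->
  (\forall x \near F, has_sum (h^~ x) (S x)) ->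
  exists2 L, has_sum l L & S x @[x --> F] --> L.
Proof.
move=> bB hb hl hS.
have lb i : `|l i| <= `|b i|.
  apply/ler_addgt0Pr => e e0.
  have := hl i; move/cvgrPdist_le => /(_ e e0) hle.
  have [x [h1 h2]] := filter_ex (filterI hb hle).
  rewrite -(subrK (h i x) (l i)) (le_trans (ler_normD _ _)) //.
  by rewrite addrC lerD // h1.
have [|L hL] := (hC l).2; first by exists B; exact: abs_bounded_le bB lb.
exists L => //; apply/cvgrPdist_le => e e0.
have e20 : 0 < e / 2 by rewrite divr_gt0.
have e40 : 0 < e / 2 / 2 by rewrite divr_gt0.
have [A0 hA0] := abs_bounded_tail bB e40.
have [d d0 dA0] : exists2 d, 0 < d & d *+ size A0 <= e / 2.
  exists (e / 2 / (size A0).+1%:R); first by rewrite divr_gt0 // ltr0n.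
  rewrite -[_ *+ size A0]mulr_natr -(mulrA (e / 2)) ler_piMr ?(ltW e20) //.
  by rewrite mulrC ler_pdivrMr ?ltr0n // mul1r ler_nat.
have near_all : \forall x \near F, 
    forall i, i \in enum_fset A0 -> `|l i - h i x| <= d.
  elim: (enum_fset A0) => [|i r IH]; first by near=> x => i.
  have := hl i; move/cvgrPdist_le => /(_ d d0) hi.
  near=> x => j; rewrite in_cons => /orP[/eqP ->|].
    by near: x.
  by move: j; near: x.
near=> x.
have hx i : `|h i x| <= `|b i| by move: i; near: x.
have Sx : has_sum (h^~ x) (S x) by near: x.
have dx i : i \in enum_fset A0 -> `|l i - h i x| <= d by move: i; near: x.
have hD := has_sumD hL (has_sumZ (-1) Sx).
rewrite -(mulN1r (S x)).
rewrite (le_trans (@has_sum_split_le _ _ _ A0 (e / 2) hD _)) //.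
  move=> A /hA0 hA; rewrite [leRHS]splitr.
  rewrite (le_trans _ (lerD hA hA)) // -big_split /=; apply: ler_sum => i _.
  by rewrite (le_trans (ler_normD _ _)) // mulN1r normrN lerD.
rewrite [leRHS]splitr lerD2r (le_trans _ dA0) //.
rewrite -[size _]count_predT -iter_addr_0 -big_const_seq.
by rewrite big_seq [leRHS]big_seq; apply: ler_sum => i iA; rewrite mulN1r; exact: dx.
Unshelve. all: by end_near. Qed.
End Tannery.

(** * Power series in one variable *)

Section OneVariable.
Variable C : numFieldType.
Hypothesis hC : summable_iff_abs_bounded C.
Implicit Types (a : nat -> C) (r s B : C) (u v : C -> C).

(** [B] bounds the weighted norm of the coefficients at radius [r]. It is
    recorded because the multiplicativity of this norm is what makes products
    and composites converge. *)
Definition power_series a r B u : Prop :=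
  abs_bounded (fun k => a k * r ^+ k) B /\
  forall t, `|t| <= r -> has_sum (fun k => a k * t ^+ k) (u t).

Lemma power_seriesW a r s B u : 0 <= s -> s <= r ->
  power_series a r B u -> power_series a s B u.
Proof.
move=> s0 sr [ab au]; split=> [|t /le_trans/(_ sr)]; last exact: au.
apply: abs_bounded_le ab _ => k; rewrite !normrM ler_wpM2l // !normrX.
by rewrite lerXn2r ?nnegrE // !ger0_norm // (le_trans s0).
Qed.

Lemma power_series_le a r B u t : power_series a r B u -> `|t| <= r ->
  `|u t| <= B.
Proof.
move=> [ab au] tr; apply: has_sum_le (au t tr) _.
apply: abs_bounded_le ab _ => k; rewrite !normrM ler_wpM2l // !normrX.
have r0 : 0 <= r := le_trans (normr_ge0 _) tr.
by rewrite lerXn2r ?nnegrE // (ger0_norm r0).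
Qed.

Lemma power_seriesD a b r A B u v :
  power_series a r A u -> power_series b r B v ->
  power_series (fun k => a k + b k) r (A + B) (fun t => u t + v t).
Proof.
move=> [aA au] [bB bv]; split=> [|t tr].
  have := abs_boundedD aA bB; congr abs_bounded.
  by apply/funext => k; rewrite mulrDl.
have := has_sumD (au t tr) (bv t tr); congr has_sum.
by apply/funext => k; rewrite mulrDl.
Qed.

Lemma power_seriesZ a r B u c : power_series a r B u ->
  power_series (fun k => c * a k) r (`|c| * B) (fun t => c * u t).
Proof.
move=> [ab au]; split=> [|t tr].
  have := abs_boundedZ c ab; congr abs_bounded.
  by apply/funext => k; rewrite mulrA.
have := has_sumZ c (au t tr); congr has_sum.
by apply/funext => k; rewrite mulrA.
Qed.

Lemma power_series_monomial i r : 0 <= r ->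
  power_series (fun k => (k == i)%:R) r (r ^+ i) (fun t => t ^+ i).
Proof.
move=> r0; have supp (x : C) : has_sum (fun k => (k == i)%:R * x ^+ k) (x ^+ i).
  have := @has_sum_finite C _ [fset i]%fset (fun k => (k == i)%:R * x ^+ k).
  rewrite big_seq_fset1 eqxx mul1r; apply=> k; rewrite inE => /negPf ->.
  by rewrite mul0r.
split=> [|t _]; last exact: supp.
by apply: has_sum_ge0_bounded (supp r) => k; rewrite mulr_ge0 ?exprn_ge0.
Qed.

Lemma power_series_shift a r B u : 0 <= r -> power_series a r B u ->
  power_series (fun k => if k is k'.+1 then a k' else 0) r (r * B)
    (fun t => t * u t).
Proof.
move=> r0 [ab au].
have supp (f : nat -> C) s : has_sum f s ->
    has_sum (fun k => if k is k'.+1 then f k' else 0) s.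
  move=> h; apply: (@has_sum_reindex _ _ _ S predn) => //.
  by case=> //= k; rewrite eqxx.
split=> [|t tr]; last first.
  have := supp _ _ (has_sumZ t (au t tr)); congr has_sum.
  by apply/funext => -[|k]; rewrite ?mul0r // exprS mulrCA.
apply: (@abs_bounded_reindex _ _ _ S predn) => //.
  by case=> [|k]; rewrite ?mul0r //= eqxx.
have := abs_boundedZ r ab; rewrite (ger0_norm r0); congr abs_bounded.
by apply/funext => k /=; rewrite exprS mulrCA.
Qed.

Lemma power_series_shiftn i a r B u : 0 <= r -> power_series a r B u ->
  exists b, power_series b r (r ^+ i * B) (fun t => t ^+ i * u t).
Proof.
move=> r0 au; elim: i => [|i [b bu]].
  exists a; rewrite mul1r; have := au; congr power_series.
  by apply/funext => t; rewrite mul1r.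
exists (fun k => if k is k'.+1 then b k' else 0).
have := power_series_shift r0 bu; rewrite mulrA -exprS; congr power_series.
by apply/funext => t; rewrite mulrA -exprS.
Qed.

(** The coefficients of the sum are the sums of the coefficients. The norm
    bound is the exchange of a finite sum over [k] with a sum over [I]; that
    the new series converges to [U] is Tannery's theorem along the finite sets
    of exponents, the partial sums of the [i]-th series being dominated by
    [b i]. *)
Lemma power_series_family (I : choiceType) (a : I -> nat -> C) r
    (b : I -> C) (u : I -> C -> C) B (U : C -> C) : 0 < r ->
  (forall i, power_series (a i) r (b i) (u i)) ->
  abs_bounded b B ->
  (forall t, `|t| <= r -> has_sum (u^~ t) (U t)) ->
  exists2 A, power_series A r B U & forall k, has_sum (a^~ k) (A k).
Proof.
move=> r0 au bB uU.
have b0 i : 0 <= b i by case: (au i) => /abs_bounded_ge0.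
have abs_k k : exists s, has_sum (fun i => `|a i k|) s.
  apply/hC; exists (r ^- k * B) => F.
  apply: le_trans (ler_wpM2l _ (bB F)); last by rewrite invr_ge0 exprn_ge0 ?ltW.
  rewrite mulr_sumr; apply: ler_sum => i _; rewrite normr_id.
  rewrite ler_pdivlMl ?exprn_gt0 // (ger0_norm (b0 i)).
  have [/(@abs_bounded_term _ _ _ _ k) + _] := au i.
  by rewrite normrM normrX (gtr0_norm r0) mulrC.
pose s k := xget 0 (has_sum (fun i => `|a i k|)).
have hs k : has_sum (fun i => `|a i k|) (s k) by apply: xgetPex; apply: abs_k.
have sum_k k : exists A, has_sum (a^~ k) A.
  apply/hC; exists (s k) => F.
  have := has_sum_ge0_bounded (fun i => normr_ge0 (a i k)) (hs k) F.
  by under eq_bigr do rewrite normr_id.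
pose A k := xget 0 (has_sum (a^~ k)).
have hA k : has_sum (a^~ k) (A k) by apply: xgetPex; apply: sum_k.
exists A => //; split=> [F|t tr].
  apply: (@le_trans _ _ (\sum_(k <- F) r ^+ k * s k)).
    apply: ler_sum => k _; rewrite normrM normrX (gtr0_norm r0) mulrC.
    by rewrite ler_wpM2l ?exprn_ge0 ?(ltW r0) //; exact: has_sum_triangle (hA k) (hs k).
  have hF := has_sum_sum F (fun k => has_sumZ (r ^+ k) (hs k)).
  have s0 : 0 <= \sum_(k <- F) r ^+ k * s k.
    apply: sumr_ge0 => k _; rewrite mulr_ge0 ?exprn_ge0 ?(ltW r0) //.
    by apply: has_sum_ge0 (hs k) => i.
  rewrite -(ger0_norm s0); apply: has_sum_le hF _.
  apply: abs_bounded_le bB _ => i.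
  rewrite (ger0_norm (b0 i)) ger0_norm; last first.
    by apply: sumr_ge0 => k _; rewrite mulr_ge0 ?exprn_ge0 ?(ltW r0).
  case: (au i) => + _ => /(_ F); apply: le_trans; apply: ler_sum => k _.
  by rewrite normrM normrX (gtr0_norm r0) mulrC.
have tr' : `|t| <= `|r| by rewrite (gtr0_norm r0).
pose h i (F : {fset nat}) := \sum_(k <- F) a i k * t ^+ k.
pose S (F : {fset nat}) := \sum_(k <- F) A k * t ^+ k.
have [|i| |L hL SL] :=
  tannery hC totally_filter (h := h) (l := u^~ t) (S := S) bB.
- apply: nearW => F i; rewrite (ger0_norm (b0 i)).
  apply: le_trans (ler_norm_sum _ _ _) _.
  case: (au i) => + _ => /(_ F); apply: le_trans; apply: ler_sum => k _.
  by rewrite !normrM ler_wpM2l // !normrX lerXn2r ?nnegrE.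
- by have [_ /(_ t tr)/has_sum_cvg] := au i.
- apply: nearW => F; have := has_sum_sum F (fun k => has_sumZ (t ^+ k) (hA k)).
  congr has_sum; last by apply: eq_bigr => k _; rewrite mulrC.
  by apply/funext => i; apply: eq_bigr => k _; rewrite mulrC.
rewrite (has_sum_unique (uU t tr) hL); exact/has_sum_cvg.
Qed.

(** The product is the family sum of the [a_i t^i v], each of which is a shift
    of [v]. *)
Lemma power_seriesM a b r A B u v : 0 < r ->
  power_series a r A u -> power_series b r B v ->
  exists c, power_series c r (A * B) (fun t => u t * v t).
Proof.
move=> r0 au bv; have r0' := ltW r0.
have shift i : {c | power_series c r (r ^+ i * B) (fun t => t ^+ i * v t)}.
  by apply: cid; apply: power_series_shiftn r0' bv.
pose c i := fun k => a i * sval (shift i) k.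
have hc i : power_series (c i) r (`|a i| * (r ^+ i * B))
    (fun t => a i * (t ^+ i * v t)).
  exact: power_seriesZ (svalP (shift i)).
have B0 : 0 <= B by case: bv => /abs_bounded_ge0.
have [|t tr|d hd _] := power_series_family (B := A * B)
  (U := fun t => u t * v t) r0 hc.
- move=> F; case: au => + _ => /(_ F) /(ler_wpM2r B0); apply: le_trans.
  rewrite mulr_suml; apply: ler_sum => i _; rewrite !normrM normr_id normrX.
  by rewrite mulrA (ger0_norm B0).
- case: au => _ /(_ t tr) /(has_sumZ (v t)); rewrite mulrC; congr has_sum.
  by apply/funext => i; rewrite mulrC mulrA.
by exists d.
Qed.

(** Without constant term each [|a_k| s^k] carries at least one factor [s / r],
    so the norm can be made small by shrinking the radius. *)
Lemma power_series_vanishing a r B u s : 0 < s -> s <= r -> a 0%N = 0 ->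
  power_series a r B u -> power_series a s (s / r * B) u.
Proof.
move=> s0 sr a0 au; have r0 := lt_le_trans s0 sr.
have [_ us] := power_seriesW (ltW s0) sr au; split=> //.
case: au => ab _ F; apply: le_trans (ler_wpM2l _ (ab F)); last first.
  by rewrite divr_ge0 ?ltW.
rewrite mulr_sumr; apply: ler_sum => -[|k] _.
  by rewrite a0 !mul0r normr0 mulr0.
rewrite !normrM mulrCA ler_wpM2l // !normrX (gtr0_norm s0) (gtr0_norm r0).
rewrite !exprS mulrA divfK ?gt_eqF // ler_wpM2l ?(ltW s0) //.
by rewrite lerXn2r ?nnegrE ?(ltW s0) ?(ltW r0).
Qed.

Lemma power_series0 a r B u : 0 <= r -> power_series a r B u -> u 0 = a 0%N.
Proof.
move=> r0 [_ /(_ 0)]; rewrite normr0 => /(_ r0) h.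
apply: has_sum_unique h _.
have := @has_sum_finite C _ [fset 0%N]%fset (fun k => a k * 0 ^+ k).
rewrite big_seq_fset1 mulr1; apply=> -[|k]; rewrite inE ?eqxx //.
by rewrite expr0n mulr0.
Qed.

(** Division by [t^k]. The quotient is defined pointwise as the sum of the
    remaining series, so its existence rests on completeness. *)
Lemma power_series_unshift k a r B u : 0 < r -> power_series a r B u ->
  (forall i, (i < k)%N -> a i = 0) ->
  exists B' v, power_series (fun i => a (k + i)%N) r B' v /\
    forall t, `|t| <= r -> u t = t ^+ k * v t.
Proof.
move=> r0 [ab au] ak.
have ab' : abs_bounded (fun i => a (k + i)%N * r ^+ i) (r ^- k * B).
  have := @abs_bounded_inj _ _ _ (addn k) _ B (@addnI k) ab.
  move=> /(abs_boundedZ (r ^- k)).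
  rewrite ger0_norm ?invr_ge0 ?exprn_ge0 ?ltW //; congr abs_bounded.
  apply/funext => i /=; rewrite exprD mulrCA mulKf //.
  by rewrite expf_neq0 ?gt_eqF.
have ex t : `|t| <= r -> exists s, has_sum (fun i => a (k + i)%N * t ^+ i) s.
  move=> tr; apply/hC; exists (r ^- k * B); apply: abs_bounded_le ab' _ => i.
  rewrite !normrM ler_wpM2l // !normrX lerXn2r ?nnegrE //.
  by rewrite (gtr0_norm r0).
pose v t := xget 0 (has_sum (fun i => a (k + i)%N * t ^+ i)).
have hv t : `|t| <= r -> has_sum (fun i => a (k + i)%N * t ^+ i) (v t).
  by move=> tr; apply: xgetPex; apply: ex.
exists (r ^- k * B), v; split=> // t tr; apply: has_sum_unique (au t tr) _.
apply: (@has_sum_reindex _ _ _ (addn k) (subn^~ k)).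
- by move=> i; rewrite addKn.
- move=> j; case: (leqP k j) => [kj|/ak -> _]; last by rewrite mul0r.
  by rewrite subnKC // eqxx.
have := has_sumZ (t ^+ k) (hv t tr); congr has_sum.
by apply/funext => i /=; rewrite exprD mulrCA.
Qed.

End OneVariable.

(** * Analytic germs in one variable *)

Section Germs.
Variable C : numFieldType.
Hypothesis hC : summable_iff_abs_bounded C.
Implicit Types (a : nat -> C) (r s B : C) (u v : C -> C).

Lemma near0P (P : C -> Prop) :
  (\forall t \near (0 : C), P t) <-> exists2 r, 0 < r & forall t, `|t| <= r -> P t.
Proof.
split=> [/nbhs_ballP [e /= e0 h]|[r r0 h]].
  exists (e / 2) => [|t te]; first by rewrite divr_gt0.
  apply: h; rewrite -ball_normE /= sub0r normrN (le_lt_trans te) //.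
  by rewrite ltr_pdivrMr // ltr_pMr // ltr1n.
apply/nbhs_ballP; exists r => //= t; rewrite -ball_normE /= sub0r normrN.
by move=> /ltW/h.
Qed.

Lemma near0_forall (I : finType) (P : I -> C -> Prop) :
  (forall i, \forall t \near (0 : C), P i t) ->
  \forall t \near (0 : C), forall i, P i t.
Proof. exact: (@filter_forall C I P (nbhs (0 : C)) (nbhs_filter _)). Qed.

Lemma common_radius (x y : C) : 0 < x -> 0 < y ->
  exists z, [/\ 0 < z, z <= x & z <= y].
Proof.
move=> x0 y0; case: (real_leP (gtr0_real x0) (gtr0_real y0)) => [xy|/ltW yx].
  by exists x.
by exists y.
Qed.

Definition analytic1 u : Prop :=
  exists a r B, 0 < r /\ power_series a r B u.

Lemma analytic1_cst c : analytic1 (fun=> c).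
Proof.
exists (fun k => c * (k == 0%N)%:R), 1, (`|c| * 1); split=> //.
have := power_seriesZ c (@power_series_monomial C 0%N 1 ler01).
by congr power_series; apply/funext => t; rewrite mulr1.
Qed.

Lemma analytic1D u v : analytic1 u -> analytic1 v ->
  analytic1 (fun t => u t + v t).
Proof.
move=> [a [r [A [r0 hu]]]] [b [s [B [s0 hv]]]].
have [x [x0 xr xs]] := common_radius r0 s0.
exists (fun k => a k + b k), x, (A + B); split=> //.
exact: power_seriesD (power_seriesW (ltW x0) xr hu)
  (power_seriesW (ltW x0) xs hv).
Qed.

Lemma analytic1M u v : analytic1 u -> analytic1 v ->
  analytic1 (fun t => u t * v t).
Proof.
move=> [a [r [A [r0 hu]]]] [b [s [B [s0 hv]]]].
have [x [x0 xr xs]] := common_radius r0 s0.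
have [c hc] := power_seriesM hC x0 (power_seriesW (ltW x0) xr hu)
  (power_seriesW (ltW x0) xs hv).
by exists c, x, (A * B).
Qed.

Lemma abs_bounded_nat (b : nat -> C) B :
  (forall N, \sum_(0 <= i < N) `|b i| <= B) -> abs_bounded b B.
Proof.
move=> h; suff aux N (F : {fset nat}) : (forall i, i \in F -> (i < N)%N) ->
    \sum_(i <- F) `|b i| <= \sum_(0 <= i < N) `|b i|.
  move=> F; apply: le_trans (h (\max_(i <- F) i).+1); apply: aux => i iF.
  by rewrite ltnS; apply: leq_bigmax_seq.
elim: N F => [|N IH] F FN.
  rewrite big_nil (_ : F = fset0) ?big_seq_fset0 //.
  by apply/fsetP => i; rewrite inE; apply/negP => /FN.
rewrite big_nat_recr //=.
have FD i : i \in (F `\ N)%fset -> (i < N)%N.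
  by rewrite !inE => /andP[iN /FN]; rewrite ltnS leq_eqVlt (negPf iN).
case: (boolP (N \in F)) => NF.
  by rewrite (big_fsetD1 N) //= addrC lerD2r; exact: IH FD.
have <- : (F `\ N)%fset = F by apply/fsetDidPl; rewrite fdisjointX1.
by rewrite ler_wpDr //; exact: IH FD.
Qed.

Lemma abs_bounded_geometric : abs_bounded (fun i => 2^-1 ^+ i : C) 2.
Proof.
apply: abs_bounded_nat => N.
suff -> : \sum_(0 <= i < N) `|2^-1 ^+ i : C| = 2 - 2 * 2^-1 ^+ N.
  by rewrite gerBl mulr_ge0 ?exprn_ge0 ?invr_ge0 ?ler0n.
elim: N => [|N IH]; first by rewrite big_nil mulr1 subrr.
rewrite big_nat_recr //= IH ger0_norm ?exprn_ge0 ?invr_ge0 ?ler0n // exprS.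
by field.
Qed.

Lemma has_sum_recl (f : nat -> C) s :
  has_sum (f \o S) s -> has_sum f (f 0%N + s).
Proof.
move=> h.
pose f0 k := if k is 0%N then f 0%N else 0.
pose f1 k := if k is k'.+1 then f k else 0.
have h0 : has_sum f0 (f 0%N).
  have := @has_sum_finite C _ [fset 0%N]%fset f0.
  by rewrite big_seq_fset1; apply=> -[|k]; rewrite inE ?eqxx.
have h1 : has_sum f1 s.
  apply: (@has_sum_reindex _ _ _ S predn f1) => // -[|k] //=.
  by rewrite eqxx.
have := has_sumD h0 h1; congr has_sum.
by apply/funext => -[|k]; rewrite /f0 /f1 ?addr0 ?add0r.
Qed.

(** With [u = a_0 (1 - w)] the inverse is the geometric series in [w]. As [w]
    has no constant term, its norm is at most [1/2] on a small disc, and the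
    powers of [w] form a summable family. Its sum [W] is recognised through
    [W = 1 + w W]. *)
Lemma analytic1_inv a r B u : 0 < r -> power_series a r B u -> a 0%N != 0 ->
  exists2 d, analytic1 d & \forall t \near (0 : C), u t * d t = 1.
Proof.
move=> r0 hu a0.
pose w t := 1 + - (a 0%N)^-1 * u t.
have [b [B' [hw bz]]] : exists b B', power_series b r B' w /\ b 0%N = 0.
  exists (fun k => (k == 0%N)%:R + - (a 0%N)^-1 * a k).
  eexists; split; last by rewrite mulNr mulVf ?subrr.
  have := power_seriesD (@power_series_monomial C 0%N r (ltW r0))
    (power_seriesZ (- (a 0%N)^-1) hu).
  exact.
have B'0 : 0 <= B' by case: hw => /abs_bounded_ge0.
(* At this radius the norm of [w] is at most [1/2]; adding 1 to [B'] allows for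
   [B' = 0]. *)
have s1 : 0 < r / (2 * (B' + 1)).
  by rewrite divr_gt0 // mulr_gt0 // ltr_wpDl.
have [s [s0 sr ss]] := common_radius r0 s1.
have hs : power_series b s 2^-1 w.
  have [bs ws] := power_series_vanishing s0 sr bz hw; split=> // F.
  apply: le_trans (bs F) _; rewrite mulrAC ler_pdivrMr //.
  move: ss; rewrite ler_pdivlMr ?mulr_gt0 ?ltr_wpDl // => ss.
  rewrite ler_pdivlMl // (le_trans _ ss) // mulrCA ler_wpM2l ?(ltW s0) //.
  by rewrite ler_wpM2l // lerDl.
have hpow i : exists c, power_series c s (2^-1 ^+ i) (fun t => w t ^+ i).
  elim: i => [|i [c hc]].
    by exists (fun k => (k == 0%N)%:R); apply: power_series_monomial (ltW s0).
  have [d hd] := power_seriesM hC s0 hs hc.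
  exists d; rewrite exprS; move: hd; congr power_series.
  by apply/funext => t; rewrite exprS.
pose c i := sval (cid (hpow i)).
have hc i : power_series (c i) s (2^-1 ^+ i) (fun t => w t ^+ i).
  exact: svalP (cid (hpow i)).
pose W t := xget 0 (has_sum (fun i => w t ^+ i)).
have hW t : `|t| <= s -> has_sum (fun i => w t ^+ i) (W t).
  move=> ts; apply: xgetPex; apply/hC; exists 2.
  apply: abs_bounded_le abs_bounded_geometric _ => i.
  rewrite [leRHS]ger0_norm ?exprn_ge0 ?invr_ge0 ?ler0n //.
  exact: power_series_le (hc i) ts.
have [e he _] := power_series_family hC s0 hc abs_bounded_geometric hW.
exists (fun t => (a 0%N)^-1 * W t).
  by apply: analytic1M; [apply: analytic1_cst | exists e, s, 2].
apply/near0P; exists s => // t ts.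
have WE : W t = 1 + w t * W t.
  apply: has_sum_unique (hW t ts) _.
  have := has_sumZ (w t) (hW t ts).
  rewrite (_ : (fun i => w t * w t ^+ i) = (fun i => w t ^+ i) \o S); last first.
    by apply/funext => i /=; rewrite exprS.
  exact: has_sum_recl.
have: (1 - w t) * W t = 1 by rewrite mulrBl mul1r {1}WE addrK.
by rewrite /w mulNr opprD addNKr opprK => <-; rewrite mulrCA mulrA.
Qed.

(** The hypothesis on coefficients forces the order of [u] to be at least that
    of [v]. If [k] is the order of [v], both series are divisible by [t^k], and [v / t^k] is a unit. *)
Lemma analytic1_divide a b r s A B u v : 0 < r -> 0 < s ->
  power_series a r A u -> power_series b s B v ->
  (forall k, b k = 0 -> a k = 0) ->
  exists2 d, analytic1 d & \forall t \near (0 : C), u t = d t * v t.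
Proof.
move=> r0 s0 hu hv ba.
have [x [x0 xr xs]] := common_radius r0 s0.
move: hu hv => /(power_seriesW (ltW x0) xr) hu /(power_seriesW (ltW x0) xs) hv.
have [/existsNP [k0 /eqP bk0]|/contrapT b0] := pselect (~ forall k, b k = 0);
  last first.
  exists (fun=> 0); first exact: analytic1_cst.
  apply/near0P; exists x => // t tx; rewrite mul0r.
  case: hu => _ /(_ t tx) h; apply: has_sum_unique h _.
  have := @has_sum_finite C _ fset0 (fun k => a k * t ^+ k).
  by rewrite big_seq_fset0; apply=> k _; rewrite ba ?mul0r.
case: (ex_minnP (ex_intro (fun k => b k != 0) k0 bk0)) => k bk kmin.
have bi i : (i < k)%N -> b i = 0.
  by move=> ik; apply/eqP; apply: contraTT ik => /kmin; rewrite -leqNgt.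
have [A' [u' [hu' uE]]] :=
  power_series_unshift hC x0 hu (fun i ik => ba i (bi i ik)).
have [B' [v' [hv' vE]]] := power_series_unshift hC x0 hv bi.
have [|d hd /near0P [y y0 dE]] := analytic1_inv x0 hv'; first by rewrite addn0.
exists (fun t => u' t * d t).
  by apply: analytic1M hd; exists (fun i => a (k + i)%N), x, A'.
have [z [z0 zx zy]] := common_radius x0 y0.
apply/near0P; exists z => // t tz.
rewrite uE ?(le_trans tz) // vE ?(le_trans tz) //.
by rewrite -mulrA [d t * _]mulrC -mulrA dE ?(le_trans tz) // mulr1 mulrC.
Qed.

(** Halving the radius pays for the factor [k] that differentiation brings. *)
Lemma le_natr_exp2 k : k%:R * 2^-1 ^+ k <= 1 :> C.
Proof.
rewrite exprVn ler_pdivrMr ?exprn_gt0 // mul1r -natrX ler_nat ltnW //.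
exact: ltn_expl.
Qed.

(** In the applications [x] is a difference of two values of a monomial of
    degree [k] on the disc of radius [r / 2], and [d] is the distance of the two
    points: the increments of the terms of a series are dominated by its terms
    at radius [r], uniformly in the two points. *)
Lemma lipschitz_domination (a x r d : C) k : 0 < r -> 0 <= d ->
  r / 2 * `|x| <= k%:R * (r / 2) ^+ k * d ->
  `|a * x| <= (r / 2)^-1 * `|a * r ^+ k| * d.
Proof.
move=> r0 d0; have r20 : 0 < r / 2 by rewrite divr_gt0.
rewrite -ler_pdivlMl // => hx.
rewrite normrM (le_trans (ler_wpM2l (normr_ge0 _) hx)) //.
rewrite normrM normrX (gtr0_norm r0).
have -> : k%:R * (r / 2) ^+ k = k%:R * 2^-1 ^+ k * r ^+ k.
  by rewrite exprMn; ring.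
rewrite [leRHS](_ : _ = `|a| * ((r / 2)^-1 * (r ^+ k * d))); last by ring.
rewrite ler_wpM2l // ler_wpM2l ?invr_ge0 ?(ltW r20) //.
rewrite -(mulrA (_ * 2^-1 ^+ _)) ler_piMl ?le_natr_exp2 //.
by rewrite !mulr_ge0 ?exprn_ge0 ?(ltW r0).
Qed.

Lemma power_series_euler a r B u : 0 < r -> power_series a r B u ->
  exists v, power_series (fun k => k%:R * a k) (r / 2) B v.
Proof.
move=> r0 [ab _].
have r20 : 0 < r / 2 by rewrite divr_gt0.
have ab' : abs_bounded (fun k => k%:R * a k * (r / 2) ^+ k) B.
  apply: abs_bounded_le ab _ => k.
  rewrite (_ : _ * _ = k%:R * 2^-1 ^+ k * (a k * r ^+ k)); last first.
    by rewrite exprMn; ring.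
  rewrite normrM ler_piMl // ger0_norm ?le_natr_exp2 //.
  by rewrite mulr_ge0 ?exprn_ge0 ?invr_ge0 ?ler0n.
have ex t : `|t| <= r / 2 -> exists s, has_sum (fun k => k%:R * a k * t ^+ k) s.
  move=> tr; apply/hC; exists B; apply: abs_bounded_le ab' _ => k.
  rewrite !normrM ler_wpM2l ?mulr_ge0 // !normrX lerXn2r ?nnegrE //.
  by rewrite (gtr0_norm r20).
exists (fun t => xget 0 (has_sum (fun k => k%:R * a k * t ^+ k))).
by split=> // t /ex h; apply: xgetPex.
Qed.

End Germs.

(** * Termwise differentiation *)

Section Derivatives.
Variable C : numFieldType.
Hypothesis hC : summable_iff_abs_bounded C.

Lemma is_deriveP (W : normedModType C) (g : C -> W) (t : C) (l : W) :
  is_derive t 1 g l <-> h^-1 *: (g (h + t) - g t) @[h --> 0^'] --> l.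
Proof.
have E : (fun h : C => h^-1 *: ((g \o shift t) (h *: 1) - g t)) =
    fun h => h^-1 *: (g (h + t) - g t).
  by apply/funext => h /=; rewrite [_%:A]mulr1.
split=> [[dg <-]|h]; first by rewrite /derive E; move: dg; rewrite /derivable E.
split; first by rewrite /derivable E; apply/cvg_ex; exists l.
by rewrite /derive E; apply: cvg_lim h.
Qed.

Lemma is_derive_locally_lipschitz (g : C -> C) (t l : C) : is_derive t 1 g l ->
  \forall h \near (0 : C), `|g (h + t) - g t| <= (`|l| + 1) * `|h|.
Proof.
move=> /is_deriveP /cvgrPdist_le /(_ 1 ltr01); rewrite near_withinE.
apply: filterS => h hl; have [->|h0] := eqVneq h 0.
  by rewrite add0r subrr !normr0 mulr0.
have {hl} := hl h0; rewrite /= => hl.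
rewrite -ler_pdivrMr ?normr_gt0 // mulrC -normfV -normrM.
rewrite -[_ * _](subrK l) addrC (le_trans (ler_normD _ _)) // lerD2l distrC.
exact: hl.
Qed.

(** Tannery's theorem for the difference quotients. *)
Lemma termwise_derivative (I : choiceType) (F : I -> C -> C) (G : C -> C)
    (l b : I -> C) B t :
  abs_bounded b B ->
  (\forall h \near (0 : C), forall i, `|F i (h + t) - F i t| <= `|b i| * `|h|) ->
  (forall i, is_derive t 1 (F i) (l i)) ->
  (\forall h \near (0 : C), has_sum (F^~ (h + t)) (G (h + t))) ->
  exists2 L, has_sum l L & is_derive t 1 G L.
Proof.
move=> bB Fb Fl FG.
have FG0 : has_sum (F^~ t) (G t).
  by have := nbhs_singleton FG; rewrite add0r.
have [|i||L hL GL] := tannery hC (Proper_dnbhs_numFieldType (0 : C))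
  (h := fun i h => h^-1 *: (F i (h + t) - F i t)) (l := l)
  (S := fun h => h^-1 *: (G (h + t) - G t)) bB.
- rewrite near_withinE; near=> h => h0 i.
  rewrite normrM normfV ler_pdivrMl ?normr_gt0 // mulrC.
  by move: i; near: h.
- exact/is_deriveP.
- rewrite near_withinE; near=> h => h0.
  have hF : has_sum (F^~ (h + t)) (G (h + t)) by near: h.
  have := has_sumZ h^-1 (has_sumD hF (has_sumZ (-1) FG0)).
  rewrite mulN1r; congr has_sum.
  by apply/funext => i; rewrite mulN1r.
by exists L => //; apply/is_deriveP.
Unshelve. all: by end_near. Qed.

Lemma is_derive_prod (J : eqType) (s : seq J) (g : J -> C -> C) (dg : J -> C) (t : C) :
  uniq s -> (forall j, is_derive t 1 (g j) (dg j)) ->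
  is_derive t 1 (fun x => \prod_(j <- s) g j x)
    (\sum_(j <- s) dg j * \prod_(i <- s | i != j) g i t).
Proof.
move=> + hg; elim: s => [_|j s IH /= /andP[js /IH hs]].
  rewrite big_nil (_ : (fun x => _) = fun=> 1); first exact: is_derive_cst.
  by apply/funext => x; rewrite big_nil.
rewrite (_ : (fun x => _) = g j * (fun x => \prod_(i <- s) g i x)); last first.
  by apply/funext => x; rewrite big_cons.
have hM := is_deriveM (hg j) hs.
apply: is_derive_eq hM _.
rewrite big_cons /= addrC; congr (_ + _).
  rewrite -[_ *: _]/(_ * _) mulrC; congr (_ * _).
  rewrite big_cons eqxx /= [LHS]big_seq [RHS]big_seq_cond; apply: eq_bigl => i.
  by case: eqP => [->|_]; rewrite ?andbT // (negPf js).
rewrite -[_ *: _]/(_ * _) mulr_sumr [LHS]big_seq [RHS]big_seq.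
apply: eq_bigr => i is_.
rewrite big_cons ifT; first by rewrite mulrCA.
by apply: contraNneq js => ->.
Qed.

End Derivatives.

(** * Power series in several variables and the chain rule *)

Section SeveralVariables.
Variable C : numFieldType.
Hypothesis hC : summable_iff_abs_bounded C.
Variable n : nat.
Implicit Types (m : {ffun 'I_n -> nat}) (z w : 'rV[C]_n).
Implicit Types (c : {ffun 'I_n -> nat} -> C) (f : 'rV[C]_n -> C).

Lemma near0_rVP (P : 'rV[C]_n -> Prop) :
  (\forall z \near (0 : 'rV[C]_n), P z) <->
  exists2 r, 0 < r & forall z, (forall i, `|z 0 i| <= r) -> P z.
Proof.
split=> [/nbhs_ballP [e /= e0 h]|[r r0 h]].
  exists (e / 2) => [|z ze]; first by rewrite divr_gt0.
  apply: h; split=> // i j; rewrite (ord1 i) -ball_normE /= mxE sub0r normrN.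
  by rewrite (le_lt_trans (ze j)) // ltr_pdivrMr // ltr_pMr // ltr1n.
apply/nbhs_ballP; exists r => //= z [_ zr]; apply: h => i.
by have := zr 0 i; rewrite -ball_normE /= mxE sub0r normrN => /ltW.
Qed.

Definition mdegree m : nat := (\sum_(i < n) m i)%N.

(** The estimate [r |x - x'| <= k r^k d] of a monomial of degree [k] is stable
    under products. It is multiplied by [r] to avoid the exponent [k - 1]. *)
Lemma prod_lipschitz (r d a a' b b' : C) (k l : nat) : 0 <= r -> 0 <= d ->
  `|b| <= r ^+ l -> `|a'| <= r ^+ k ->
  r * `|a - a'| <= k%:R * r ^+ k * d -> r * `|b - b'| <= l%:R * r ^+ l * d ->
  r * `|a * b - a' * b'| <= (k + l)%:R * r ^+ (k + l) * d.
Proof.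
move=> r0 d0 hb ha' hab hbb.
have -> : a * b - a' * b' = (a - a') * b + a' * (b - b') by ring.
apply: (@le_trans _ _ (r * `|a - a'| * `|b| + `|a'| * (r * `|b - b'|))).
  rewrite mulrCA -mulrA -mulrDr ler_wpM2l // -!normrM.
  exact: ler_normD.
have -> : (k + l)%:R * r ^+ (k + l) * d =
    k%:R * r ^+ k * d * r ^+ l + r ^+ k * (l%:R * r ^+ l * d).
  by rewrite natrD exprD; ring.
by apply: lerD; apply: ler_pM => //; rewrite mulr_ge0.
Qed.

Lemma expr_lipschitz (x y r d : C) k : 0 <= d ->
  `|x| <= r -> `|y| <= r -> `|x - y| <= d ->
  r * `|x ^+ k - y ^+ k| <= k%:R * r ^+ k * d.
Proof.
move=> d0 xr yr xy; have r0 : 0 <= r := le_trans (normr_ge0 _) xr.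
elim: k => [|k IH]; first by rewrite !expr0 subrr normr0 mulr0 !mul0r.
rewrite (exprS x) (exprS y) -(add1n k); apply: prod_lipschitz => //.
- by rewrite normrX lerXn2r ?nnegrE.
- by rewrite mul1r expr1 ler_wpM2l.
Qed.

Lemma monomial_lipschitz m z w r d : 0 <= d ->
  (forall i, `|z 0 i| <= r) -> (forall i, `|w 0 i| <= r) ->
  (forall i, `|z 0 i - w 0 i| <= d) -> 0 <= r ->
  r * `|monomial m z - monomial m w| <= (mdegree m)%:R * r ^+ mdegree m * d.
Proof.
move=> d0 zr wr zw r0.
have power i k : [/\ `|z 0 i ^+ k| <= r ^+ k, `|w 0 i ^+ k| <= r ^+ k &
    r * `|z 0 i ^+ k - w 0 i ^+ k| <= k%:R * r ^+ k * d].
  split; try by rewrite normrX lerXn2r ?nnegrE // (le_trans _ (zr i)).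
  exact: expr_lipschitz.
rewrite /monomial /mdegree.
pose K (a b : C) (k : nat) := [/\ `|a| <= r ^+ k, `|b| <= r ^+ k &
  r * `|a - b| <= k%:R * r ^+ k * d].
suff [] : K (\prod_(i < n) z 0 i ^+ m i) (\prod_(i < n) w 0 i ^+ m i)
  (\sum_(i < n) m i)%N by [].
apply: (big_ind3 K) => [|a a' k b b' l [h1 h2 h3] [h4 h5 h6]|i _]; last exact: power.
  by split; rewrite ?normr1 ?subrr ?normr0 ?mulr0 ?mul0r.
split; last exact: prod_lipschitz.
  by rewrite normrM exprD ler_pM.
by rewrite normrM exprD ler_pM.
Qed.

Definition multi_power_series c r B f : Prop :=
  abs_bounded (fun m => c m * r ^+ mdegree m) B /\
  forall z, (forall i, `|z 0 i| <= r) ->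
    has_sum (fun m => c m * monomial m z) (f z).

(** Convergence at the corner [(r, ..., r)] of a polydisc bounds the
    coefficients, because an unconditionally convergent series is absolutely
    bounded. *)
Lemma analytic0_multi_power_series f : analytic0 f ->
  exists c r B, 0 < r /\ multi_power_series c r B f.
Proof.
move=> [c /near0_rVP [r r0 hf]]; exists c, r.
have hs z : (forall i, `|z 0 i| <= r) -> has_sum (fun m => c m * monomial m z) (f z).
  by move=> /hf/has_sumP.
have [|B hB] := (hC (fun m => c m * monomial m (const_mx r))).1.
  by exists (f (const_mx r)); apply: hs => i; rewrite mxE gtr0_norm.
exists B; split=> //; split=> //; move: hB; congr abs_bounded.
apply/funext => m; rewrite /monomial /mdegree -prodrXr.
by congr (_ * _); apply: eq_bigr => i _; rewrite mxE.
Qed.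

(** At [m j = 0] the exponent [(m j).-1] is meaningless, but the factor
    [(m j)%:R] vanishes. *)
Definition partial_monomial m z (j : 'I_n) : C :=
  (m j)%:R * z 0 j ^+ (m j).-1 * \prod_(i < n | i != j) z 0 i ^+ m i.

(** Along a curve through a point well inside the polydisc, the series is
    differentiated term by term. Differentiability of the curve at [t] already
    gives a Lipschitz bound at [t], which turns into a domination of all the
    difference quotients at once. Both the partial derivatives of [f] and the
    chain rule are instances. *)
Lemma multi_power_series_comp_derive c r B f (g : C -> 'rV[C]_n) (t : C)
    (l : 'I_n -> C) : 0 < r -> multi_power_series c r B f ->
  (forall i, `|g t 0 i| < r / 2) ->
  (forall i, is_derive t 1 (fun x => g x 0 i) (l i)) ->
  exists2 L, has_sum (fun m => c m * \sum_(j < n) l j * partial_monomial m (g t) j) L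
    & is_derive t 1 (f \o g) L.
Proof.
move=> r0 [cB cf] gt dg.
have r20 : 0 < r / 2 by rewrite divr_gt0.
pose K := \sum_(i < n) (`|l i| + 1).
have K0 : 0 <= K by apply: sumr_ge0 => i _; rewrite addr_ge0.
have lK i : `|l i| + 1 <= K.
  by rewrite /K (bigD1 i) //= lerDl sumr_ge0 // => j _; rewrite addr_ge0.
have near_lip : \forall h \near (0 : C), forall i,
    `|g (h + t) 0 i - g t 0 i| <= K * `|h|.
  apply: near0_forall => i; have := is_derive_locally_lipschitz (dg i).
  by apply: filterS => h /le_trans; apply; rewrite ler_wpM2r.
have near_r : \forall h \near (0 : C), forall i, `|g (h + t) 0 i| <= r / 2.
  apply: near0_forall => i; have := is_derive_locally_lipschitz (dg i).
  have d0 : 0 < (r / 2 - `|g t 0 i|) / (`|l i| + 1).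
    by rewrite divr_gt0 ?subr_gt0 // ltr_wpDl.
  have hd : \forall h \near (0 : C), `|h| <= (r / 2 - `|g t 0 i|) / (`|l i| + 1).
    by apply/near0P; eexists; first exact: d0.
  move: hd; apply: filterS2 => h hd hl.
  rewrite -(subrK (g t 0 i) (g (h + t) 0 i)) (le_trans (ler_normD _ _)) //.
  rewrite -lerBrDr (le_trans hl) //.
  by move: hd; rewrite ler_pdivlMr ?ltr_wpDl // mulrC.
have dm m : is_derive t 1 (fun x => c m * monomial m (g x))
    (c m * \sum_(j < n) l j * partial_monomial m (g t) j).
  have dgm j : is_derive t 1 (fun x => g x 0 j ^+ m j)
      ((m j)%:R * g t 0 j ^+ (m j).-1 * l j).
    have := is_deriveX (m j) (dg j).
    rewrite (_ : _ ^+ m j = fun x => g x 0 j ^+ m j) //.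
    by apply/funext => x; rewrite exprfctE.
  have := is_deriveZ (c m) (is_derive_prod (index_enum_uniq _) dgm).
  move=> h; apply: is_derive_eq h _; rewrite -[_ *: _]/(_ * _); congr (_ * _).
  apply: eq_bigr => j _; rewrite /partial_monomial.
  by ring.
have [||L hL dL] := @termwise_derivative C hC _
  (fun m x => c m * monomial m (g x)) (f \o g)
  (fun m => c m * \sum_(j < n) l j * partial_monomial m (g t) j)
  (fun m => (K / (r / 2)) * (c m * r ^+ mdegree m)) _ t
  (abs_boundedZ (K / (r / 2)) cB).
- near=> h => m.
  have gh : forall i, `|g (h + t) 0 i| <= r / 2 by near: h.
  have lh : forall i, `|g (h + t) 0 i - g t 0 i| <= K * `|h| by near: h.
  have d0 : 0 <= K * `|h| by rewrite mulr_ge0.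
  have := monomial_lipschitz m d0 gh (fun i => ltW (gt i)) lh (ltW r20).
  move=> /(lipschitz_domination (c m) r0 d0) hm.
  rewrite -mulrBr (le_trans hm) // (normrM (K / _)).
  rewrite (ger0_norm (divr_ge0 K0 (ltW r20))).
  set a := `|c m * _|; rewrite [leLHS](_ : _ = K / (r / 2) * a * `|h|) //.
  by ring.
- near=> h; apply: cf => i; rewrite (@le_trans _ _ (r / 2)) //.
    by move: i; near: h.
  by rewrite ler_pdivrMr // ler_peMr ?(ltW r0) // ler1n.
by exists L.
Unshelve. all: by end_near. Qed.

(** The termwise derivative along the line through [z] in the [j]-th
    direction. *)
Lemma multi_power_series_partial c r B f z j : 0 < r ->
  multi_power_series c r B f -> (forall i, `|z 0 i| < r / 2) ->
  has_sum (fun m => c m * partial_monomial m z j) ('D_(delta_mx 0 j) f z).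
Proof.
move=> r0 cf zr; pose g (h : C) : 'rV[C]_n := h *: delta_mx 0 j + z.
have g0 : g 0 = z by rewrite /g scale0r add0r.
have [|i|L hL /is_deriveP dL] := @multi_power_series_comp_derive c r B f g 0
    (fun i => (i == j)%:R) r0 cf.
- by rewrite g0.
- have -> : (fun x => g x 0 i) = (fun x => (i == j)%:R * x) + (fun=> z 0 i).
    by apply/funext => x; rewrite !mxE eqxx /= mulrC.
  have h := is_deriveD (is_deriveZ ((i == j)%:R : C) (is_derive_id (0 : C) 1))
    (is_derive_cst (z 0 i) (0 : C) 1).
  by apply: is_derive_eq h _; rewrite addr0 -[LHS]/(_ * _) mulr1.
have -> : 'D_(delta_mx 0 j) f z = L.
  rewrite /derive; apply: cvg_lim => //; move: dL.
  by under eq_fun do rewrite addr0; rewrite /= g0.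
move: hL; rewrite g0; congr has_sum; apply/funext => m; congr (_ * _).
rewrite (bigD1 j) //= eqxx mul1r big1 ?addr0 // => i /negPf ->.
by rewrite mul0r.
Qed.

(** The termwise derivative is linear in the velocity [l] of the curve, so it
    is determined by its values in the coordinate directions, which are the
    partial derivatives. *)
Lemma chain_rule c r B f (g : C -> 'rV[C]_n) (t : C) (l : 'I_n -> C) :
  0 < r -> multi_power_series c r B f ->
  (forall i, `|g t 0 i| < r / 2) ->
  (forall i, is_derive t 1 (fun x => g x 0 i) (l i)) ->
  is_derive t 1 (f \o g) (\sum_(j < n) l j * 'D_(delta_mx 0 j) f (g t)).
Proof.
move=> r0 cf gt dg.
have [L hL dL] := multi_power_series_comp_derive r0 cf gt dg.
apply: is_derive_eq dL _; apply: has_sum_unique hL _.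
have := has_sum_sum (index_enum 'I_n)
  (fun j => has_sumZ (l j) (multi_power_series_partial j r0 cf gt)).
congr has_sum; apply/funext => m; rewrite mulr_sumr.
by apply: eq_bigr => j _; rewrite mulrCA.
Qed.

Lemma analytic1_small (u : C -> C) (r : C) : analytic1 u -> u 0 = 0 -> 0 < r ->
  exists2 s, 0 < s & forall x, 0 < x -> x <= s -> exists a, power_series a x r u.
Proof.
move=> [a [s [B [s0 hu]]]] u0 r0.
have B0 : 0 <= B by case: hu => /abs_bounded_ge0.
have d0 : 0 < r * s / (B + 1) by rewrite divr_gt0 ?mulr_gt0 // ltr_wpDl.
have [y [y0 ys yd]] := common_radius s0 d0.
exists y => // x x0 xy; exists a.
have a0 : a 0%N = 0 by rewrite -(power_series0 (ltW s0) hu).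
have [ax ux] := power_series_vanishing x0 (le_trans xy ys) a0 hu.
split=> // F; apply: le_trans (ax F) _.
rewrite mulrAC ler_pdivrMr //.
have := le_trans xy yd; rewrite ler_pdivlMr ?ltr_wpDl //; apply: le_trans.
by rewrite ler_wpM2l ?(ltW x0) // lerDl.
Qed.

(** On a small disc all the components of the curve have norm at most [r], so
    the composite of the monomial [m] has norm at most [r ^+ mdegree m], and the
    composites form a summable family. *)
Lemma analytic1_comp c r B f (g : 'I_n -> C -> C) : 0 < r ->
  multi_power_series c r B f ->
  (forall i, analytic1 (g i)) -> (forall i, g i 0 = 0) ->
  analytic1 (fun t => f (\row_i g i t)).
Proof.
move=> r0 [cB cf] ga g0.
have [s s0 hs] : exists2 s, 0 < s & forall i, exists a, power_series a s r (g i).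
  suff [s s0 hs] : exists2 s, 0 < s & forall i, i \in index_enum 'I_n ->
      forall x, 0 < x -> x <= s -> exists a, power_series a x r (g i).
    by exists s => // i; apply: hs; rewrite ?mem_index_enum.
  elim: (index_enum _) => [|j e [s s0 hs]]; first by exists 1.
  have [y y0 hy] := analytic1_small (ga j) (g0 j) r0.
  have [x [x0 xs xy]] := common_radius s0 y0.
  exists x => // i; rewrite in_cons => /orP[/eqP -> x' x'0 x'x|ie x' x'0 x'x].
    by apply: hy => //; apply: le_trans xy.
  by apply: hs => //; apply: le_trans xs.
have gm m : exists a, power_series a s (r ^+ mdegree m)
    (fun t => monomial m (\row_i g i t)).
  rewrite /monomial /mdegree -prodrXr.
  elim: (index_enum _) => [|j e [a IH]].
    exists (fun k => (k == 0%N)%:R).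
    have := @power_series_monomial C 0%N s (ltW s0); rewrite big_nil.
    by congr power_series; apply/funext => t; rewrite big_nil.
  have [b hb] : exists b, power_series b s (r ^+ m j) (fun t => g j t ^+ m j).
    elim: (m j) => [|k [b hb]].
      by exists (fun k => (k == 0%N)%:R); apply: power_series_monomial (ltW s0).
    have [a' ha'] := hs j; have [d hd] := power_seriesM hC s0 ha' hb.
    exists d; rewrite exprS; move: hd; congr power_series.
    by apply/funext => t; rewrite exprS.
  have [d hd] := power_seriesM hC s0 hb IH.
  exists d; rewrite big_cons; move: hd; congr power_series.
  by apply/funext => t; rewrite big_cons mxE.
have gb t : `|t| <= s -> forall i, `|(\row_i g i t) 0 i| <= r.
  by move=> ts i; rewrite mxE; have [a ha] := hs i; apply: power_series_le ha ts.
have hm m : power_series (fun k => c m * sval (cid (gm m)) k) s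
    (`|c m| * r ^+ mdegree m) (fun t => c m * monomial m (\row_i g i t)).
  exact: power_seriesZ (svalP (cid (gm m))).
have [||A hA _] := power_series_family hC (B := B)
    (U := fun t => f (\row_i g i t)) s0 hm.
- move=> F; apply: le_trans (cB F); apply: ler_sum => m _.
  by rewrite !normrM normr_id.
- by move=> t /gb /cf.
by exists A, s, B.
Qed.

End SeveralVariables.

(** * The Euler derivative of a germ *)

Section Saturation.
Variable C : numFieldType.
Hypothesis hC : summable_iff_abs_bounded C.

Definition euler (u : C -> C) (t : C) : C := t * 'D_1 u t.

Lemma analytic1_near (u v : C -> C) : (\forall t \near (0 : C), u t = v t) ->
  analytic1 u -> analytic1 v.
Proof.
move=> /near0P [s s0 uv] [a [r [B [r0 hu]]]].
have [x [x0 xs xr]] := common_radius s0 r0.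
have [ax ux] := power_seriesW (ltW x0) xr hu.
exists a, x, B; split=> //; split=> // t tx; rewrite -uv; first exact: ux.
exact: le_trans tx xs.
Qed.

(** The formal Euler derivative is the actual one. The inequality on
    [t] is strict so that the series converges on a neighbourhood of [t]. *)
Lemma power_series_derive (a : nat -> C) r B u v (t : C) : 0 < r ->
  power_series a r B u -> power_series (fun k => k%:R * a k) (r / 2) B v ->
  `|t| < r / 2 -> derivable u t 1 /\ v t = euler u t.
Proof.
move=> r0 [aB au] [_ av] tr; have r20 : 0 < r / 2 by rewrite divr_gt0.
pose l k := a k * (k%:R * t ^+ k.-1).
have dl k : is_derive t 1 (fun x => a k * x ^+ k) (l k).
  have hk := DeriveDef (@exprn_derivable C k t 1) (exp_derive k t 1).
  apply: is_derive_eq (is_deriveZ (a k) hk) _.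
  by rewrite /l -[_ *: 1]/(_ * 1) mulr1.
have near_r : \forall h \near (0 : C), `|h + t| <= r / 2.
  apply/near0P; exists (r / 2 - `|t|); first by rewrite subr_gt0.
  by move=> h hr; rewrite (le_trans (ler_normD _ _)) // -lerBrDr.
have half : r / 2 <= r by rewrite ler_pdivrMr // ler_peMr ?(ltW r0) // ler1n.
have [||L hL dL] := @termwise_derivative C hC _ (fun k x => a k * x ^+ k) u l
  (fun k => (r / 2)^-1 * (a k * r ^+ k)) _ t (abs_boundedZ (r / 2)^-1 aB).
- move: near_r; apply: filterS => h hr k.
  have hth : `|h + t - t| <= `|h| by rewrite addrK.
  have := expr_lipschitz k (normr_ge0 h) hr (ltW tr) hth.
  move=> /(lipschitz_domination (a k) r0 (normr_ge0 h)) hk.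
  rewrite -mulrBr (le_trans hk) // (normrM (r / 2)^-1).
  by rewrite (gtr0_norm (_ : 0 < (r / 2)^-1)) ?invr_gt0.
- by move: near_r; apply: filterS => h hr; apply: au; apply: le_trans hr half.
split=> //; rewrite /euler derive_val.
apply: has_sum_unique (av t (ltW tr)) _.
have := has_sumZ t hL; congr has_sum; apply/funext => -[|k].
  by rewrite /l !mul0r !mulr0.
by rewrite /l /= exprS; ring.
Qed.

(** A coefficient of [E u] vanishes where that of [u] does; conversely, if
    [k a_k = 0] then [k = 0] or [a_k = 0], and the exception [k = 0] is excluded
    by [u 0 = 0]. So each of [u] and [E u] divides the other. *)
Lemma analytic1_euler u : analytic1 u ->
  [/\ analytic1 (euler u), \forall t \near (0 : C), derivable u t 1,
      u 0 = 0 -> exists2 c, analytic1 c &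
        \forall t \near (0 : C), u t = c t * euler u t &
      exists2 d, analytic1 d & \forall t \near (0 : C), euler u t = d t * u t].
Proof.
move=> [a [r [B [r0 hu]]]]; have [v hv] := power_series_euler hC r0 hu.
have r20 : 0 < r / 2 by rewrite divr_gt0.
have r40 : 0 < r / 2 / 2 by rewrite divr_gt0.
have huv t : `|t| <= r / 2 / 2 -> derivable u t 1 /\ v t = euler u t.
  move=> tr; apply: (power_series_derive r0 hu hv); apply: le_lt_trans tr _.
  by rewrite ltr_pdivrMr // ltr_pMr // ltr1n.
have vE : \forall t \near (0 : C), v t = euler u t.
  by apply/near0P; exists (r / 2 / 2) => // t /huv[].
split.
- by apply: analytic1_near vE _; exists (fun k => k%:R * a k), (r / 2), B.
- by apply/near0P; exists (r / 2 / 2) => // t /huv[].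
- move=> u0; have a0 : a 0%N = 0 by rewrite -(power_series0 (ltW r0) hu).
  have [|c hc uE] := analytic1_divide hC r0 r20 hu hv.
    case=> [//|k] /eqP; rewrite mulf_eq0 pnatr_eq0 /= => /eqP //.
  exists c => //; near=> t.
  have <- : v t = euler u t by near: t.
  by near: t.
have [|d hd uE] := analytic1_divide hC r20 r0 hv hu.
  by move=> k ->; rewrite mulr0.
exists d => //; near=> t.
have <- : v t = euler u t by near: t.
by near: t.
Unshelve. all: by end_near. Qed.

(** * Germs on row vectors *)

Lemma const_mx1 (z : 'rV[C]_1) : const_mx (z 0 0) = z.
Proof. by apply/rowP => i; rewrite (ord1 i) mxE. Qed.

Lemma near0_rV1P (P : 'rV[C]_1 -> Prop) :
  (\forall z \near (0 : 'rV[C]_1), P z) <->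
  (\forall t \near (0 : C), P (const_mx t)).
Proof.
split=> [/near0_rVP|/near0P] [r r0 h].
  by apply/near0P; exists r => // t tr; apply: h => i; rewrite mxE.
by apply/near0_rVP; exists r => // z zr; rewrite -(const_mx1 z); apply: h.
Qed.

Let cst_index (k : nat) : {ffun 'I_1 -> nat} := [ffun=> k].
Let cst_indexK : cancel cst_index (fun m => m ord0).
Proof. by move=> k; rewrite ffunE. Qed.
Let index_cstK : cancel (fun m : {ffun 'I_1 -> nat} => m ord0) cst_index.
Proof. by move=> m; apply/ffunP => i; rewrite ffunE (ord1 i). Qed.

Lemma monomial1 (m : {ffun 'I_1 -> nat}) (z : 'rV[C]_1) :
  monomial m z = z 0 0 ^+ m ord0.
Proof. by rewrite /monomial big_ord1. Qed.

Lemma analytic1_curve (u : 'rV[C]_1 -> C) : analytic0 u ->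
  analytic1 (fun t => u (const_mx t)).
Proof.
move=> /(analytic0_multi_power_series hC) [c [r [B [r0 [cB cu]]]]].
exists (fun k => c (cst_index k)), r, B; split=> //; split=> [|t tr].
  have := abs_bounded_inj (can_inj cst_indexK) cB; congr abs_bounded.
  by apply/funext => k /=; rewrite /mdegree big_ord1 ffunE.
have tr' (i : 'I_1) : `|(const_mx t : 'rV[C]_1) 0 i| <= r by rewrite mxE.
have [_ bij] := @has_sum_bij C _ _ cst_index (fun m => m ord0)
  (fun m => c m * monomial m (const_mx t)) (u (const_mx t)) cst_indexK index_cstK.
have := bij (cu _ tr'); congr has_sum; apply/funext => k /=.
by rewrite monomial1 mxE ffunE.
Qed.

Lemma analytic1_analytic0 (u : C -> C) : analytic1 u ->
  analytic0 (fun z : 'rV[C]_1 => u (z 0 0)).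
Proof.
move=> [a [r [B [r0 [_ au]]]]]; exists (fun m => a (m ord0)).
apply/near0_rVP; exists r => // z zr; apply/has_sumP.
have [bij _] := @has_sum_bij C _ _ cst_index (fun m => m ord0)
  (fun m => a (m ord0) * monomial m z) (u (z 0 0)) cst_indexK index_cstK.
apply: bij; have := au (z 0 0) (zr 0); congr has_sum; apply/funext => k /=.
by rewrite monomial1 ffunE.
Qed.

Lemma analytic0_cst n (k : C) : analytic0 (fun _ : 'rV[C]_n => k).
Proof.
pose m0 : {ffun 'I_n -> nat} := [ffun=> 0%N].
exists (fun m => if m == m0 then k else 0).
apply/near0_rVP; exists 1 => // z _; apply/has_sumP.
have := @has_sum_finite C _ [fset m0]%fset
  (fun m => (if m == m0 then k else 0) * monomial m z).
rewrite big_seq_fset1 eqxx /monomial big1 ?mulr1; last first.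
  by move=> i _; rewrite ffunE.
by apply=> m; rewrite inE => /negPf ->; rewrite mul0r.
Qed.

Lemma analytic0_coord n (i : 'I_n) : analytic0 (fun z : 'rV[C]_n => z 0 i).
Proof.
pose m1 : {ffun 'I_n -> nat} := [ffun j => (j == i) : nat].
exists (fun m => (m == m1)%:R).
apply/near0_rVP; exists 1 => // z _; apply/has_sumP.
have m1E : monomial m1 z = z 0 i.
  rewrite /monomial (bigD1 i) //= ffunE eqxx expr1 big1 ?mulr1 // => j /negPf ji.
  by rewrite ffunE ji.
have := @has_sum_finite C _ [fset m1]%fset
  (fun m => (m == m1)%:R * monomial m z).
rewrite big_seq_fset1 eqxx mul1r m1E.
by apply=> m; rewrite inE => /negPf ->; rewrite mul0r.
Qed.

(** * The double of the Jacobian ideal along a curve *)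

Lemma submod_gen_sum n (W : lmodType C) (S : set ('rV[C]_n -> W))
    (T : finType) (a : T -> 'rV[C]_n -> C) (s : T -> 'rV[C]_n -> W) g :
  (forall i, analytic0 (a i)) -> (forall i, S (s i)) ->
  (\forall z \near (0 : 'rV[C]_n), g z = \sum_i a i z *: s i z) ->
  submod_gen S g.
Proof.
move=> ha hs hg; exists #|T|, (fun j => a (enum_val j)), (fun j => s (enum_val j)).
split=> [j|j|]; [exact: ha | exact: hs |].
move: hg; apply: filterS => z ->; rewrite (reindex (@enum_val T T)) //=.
exact/onW_bij/enum_val_bij.
Qed.

(** The generator [(0, (z_j - w_j) h(w))] is [z_j h_D - (z_j h)_D]: multiplying
    inside and outside the double differ exactly by this element. *)
Lemma doubled_module_second n (I : set ('rV[C]_n -> C)) (h : 'rV[C]_n -> C) (j : 'I_n) :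
  I h -> I (fun z => z 0 j * h z) ->
  doubled_module I (fun w => (0, (lsubmx w 0 j - rsubmx w 0 j) * h (rsubmx w))).
Proof.
move=> Ih Izh.
apply: (@submod_gen_sum _ _ _ bool
  (fun b w => if b then w 0 (lshift n j) else - 1)
  (fun b => doubled (fun z : 'rV[C]_n => if b then h z else z 0 j * h z))).
- by case; [exact: analytic0_coord | exact: analytic0_cst].
- by case; [exists h | exists (fun z : 'rV[C]_n => z 0 j * h z)].
apply/near0_rVP; exists 1 => // w _; rewrite big_bool /= /doubled.
congr pair => /=.
  by rewrite mxE -[X in _ = X + _]/(_ * _) -[X in _ = _ + X]/(_ * _); ring.
rewrite !mxE -[X in _ = X + _]/(_ * _) -[X in _ = _ + X]/(_ * _); ring.
Qed.

Lemma jacobian_partial n (f : 'rV[C]_n -> C) (i : 'I_n) (a : 'rV[C]_n -> C) :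
  analytic0 a -> jacobian_ideal f (fun z => a z * 'D_(delta_mx 0 i) f z).
Proof.
move=> ha; apply: (@submod_gen_sum _ _ _ unit (fun=> a)
  (fun=> 'D_(delta_mx 0 i) f)) => [//|_|]; first by exists i.
apply/near0_rVP; exists 1 => // z _.
by rewrite (bigD1 tt) //= big1 ?addr0 // => -[].
Qed.

(** Pulling back along a curve without constant term, with the chain rule
    multiplied by [t]. *)
Lemma analytic1_pullback n (f : 'rV[C]_n -> C) (x : 'I_n -> C -> C) :
  analytic0 f -> (forall j, analytic1 (x j)) -> (forall j, x j 0 = 0) ->
  analytic1 (fun t => f (\row_j x j t)) /\
  \forall t \near (0 : C), euler (fun t => f (\row_j x j t)) t =
    \sum_(j < n) euler (x j) t * 'D_(delta_mx 0 j) f (\row_j x j t).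
Proof.
move=> /(analytic0_multi_power_series hC) [c [r [B [r0 cf]]]] xa x0.
split; first exact: analytic1_comp cf xa x0.
have near_r : \forall t \near (0 : C), forall j, `|x j t| < r / 2.
  apply: near0_forall => j; have r40 : 0 < r / 2 / 2 by rewrite !divr_gt0.
  have [s s0 /(_ s s0 (lexx _)) [a ha]] := analytic1_small (xa j) (x0 j) r40.
  apply/near0P; exists s => // t ts.
  apply: le_lt_trans (power_series_le ha ts) _.
  by rewrite ltr_pdivrMr // ltr_pMr ?ltr1n // divr_gt0.
have near_d : \forall t \near (0 : C), forall j, derivable (x j) t 1.
  by apply: near0_forall => j; have [] := analytic1_euler (xa j).
near=> t.
have xr : forall j, `|x j t| < r / 2 by near: t.
have xd : forall j, derivable (x j) t 1 by near: t.
have gr i : `|(\row_j x j t) 0 i| < r / 2 by rewrite mxE.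
have gd i : is_derive t 1 (fun s => (\row_j x j s) 0 i) ('D_1 (x i) t).
  have := derivableP (xd i); congr is_derive.
  by apply/funext => s; rewrite mxE.
have [_ dE] := chain_rule hC r0 cf gr gd.
move: dE; rewrite /euler /comp => ->.
by rewrite mulr_sumr; apply: eq_bigr => j _; rewrite mulrA.
Unshelve. all: by end_near. Qed.

Lemma sum_scale_pair (T : finType) (a b e : T -> C) :
  \sum_i a i *: ((b i, e i) : C * C) = (\sum_i a i * b i, \sum_i a i * e i).
Proof.
by apply: (big_ind3 (fun (p : C * C) u v => p = (u, v))) => // p u v q u' v' -> ->.
Qed.

(** The decomposition of [(g, g)] explained at the top, over any field where
    absolute convergence behaves well. *)
Lemma mem_rel_lipschitz_saturation_jacobian n (f : 'rV[C]_n -> C) :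
  analytic0 f -> f 0 = 0 ->
  rel_lipschitz_saturation f (jacobian_ideal f) f.
Proof.
move=> f_an f0; split=> // phi [phi0 phi_an] /near0_rV1P phiX.
pose x j t := phi (const_mx t) 0 (lshift n j).
pose y j t := phi (const_mx t) 0 (rshift n j).
have xa j : analytic1 (x j) by apply: analytic1_curve (phi_an _).
have ya j : analytic1 (y j) by apply: analytic1_curve (phi_an _).
have c0 : const_mx 0 = 0 :> 'rV[C]_1 by apply/rowP => i; rewrite !mxE.
have x0 j : x j 0 = 0 by rewrite /x c0 phi0 mxE.
have y0 j : y j 0 = 0 by rewrite /y c0 phi0 mxE.
have lE t : lsubmx (phi (const_mx t)) = \row_j x j t.
  by apply/rowP => j; rewrite !mxE.
have rE t : rsubmx (phi (const_mx t)) = \row_j y j t.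
  by apply/rowP => j; rewrite !mxE.
pose g t := f (\row_j x j t).
have [ga gE] := analytic1_pullback f_an xa x0.
have [_ hE] := analytic1_pullback f_an ya y0.
have gh : \forall t \near (0 : C), g t = f (\row_j y j t).
  by move: phiX; apply: filterS => t; rewrite /fiber_square /= lE rE.
(* Derivatives are local: [f o x] and [f o y] agree near every point near 0. *)
have ghE : \forall t \near (0 : C),
    euler g t = euler (fun t => f (\row_j y j t)) t.
  by move: (near_join gh); apply: filterS => t /near_eq_derive E; rewrite /euler E.
have g0 : g 0 = 0.
  by rewrite /g (_ : \row_j _ = 0) //; apply/rowP => j; rewrite !mxE x0.
(* This is where [f 0 = 0] enters: a constant is not a multiple of its
   derivative. *)
have [_ _ /(_ g0) [c ca cE] _] := analytic1_euler ga.
have diff j : exists2 d, analytic1 d & \forall t \near (0 : C),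
    euler (x j) t - euler (y j) t = d t * (x j t - y j t).
  have da : analytic1 (fun t => x j t + -1 * y j t).
    by apply: analytic1D => //; apply: analytic1M => //; apply: analytic1_cst.
  have [_ _ _ [d d_an dE]] := analytic1_euler da; exists d => //.
  have [_ xd _ _] := analytic1_euler (xa j).
  have [_ yd _ _] := analytic1_euler (ya j).
  near=> t.
  have xdt : derivable (x j) t 1 by near: t.
  have ydt : derivable (y j) t 1 by near: t.
  have : euler (fun t => x j t + -1 * y j t) t = d t * (x j t + -1 * y j t).
    by near: t.
  rewrite /euler; have -> : (fun t => x j t + -1 * y j t) = x j - y j.
    by apply/funext => s; rewrite mulN1r.
  by rewrite deriveB // mulrBr !mulN1r.
pose d j := s2val (cid2 (diff j)).
have da j : analytic1 (d j) := s2valP (cid2 (diff j)).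
have dE : \forall t \near (0 : C), forall j,
    euler (x j) t - euler (y j) t = d j t * (x j t - y j t).
  apply: near0_forall => j.
  exact: s2valP' (cid2 (diff j)).
pose Df j := 'D_(delta_mx 0 j) f.
(* Two generators for each coordinate [j]: the double of [D_j f], and the
   element that corrects its second component. *)
pose coef (i : 'I_n + 'I_n) t := match i with
  | inl j => c t * euler (x j) t
  | inr j => -1 * (c t * d j t) end.
pose gen (i : 'I_n + 'I_n) : 'rV[C]_(n + n) -> C * C := match i with
  | inl j => doubled (Df j)
  | inr j => fun w => (0, (lsubmx w 0 j - rsubmx w 0 j) * Df j (rsubmx w)) end.
apply: (@submod_gen_sum _ _ _ _ (fun i z => coef i (z 0 0))
  (fun i => gen i \o phi)) => [[]j|[]j|].
- apply: analytic1_analytic0; apply: analytic1M => //.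
  by have [] := analytic1_euler (xa j).
- have := analytic1M hC (analytic1_cst (-1)) (analytic1M hC ca (da j)).
  exact: analytic1_analytic0.
- exists (doubled (Df j)) => //.
  apply: (@submod_gen_sum _ _ _ unit (fun=> fun=> 1) (fun=> doubled (Df j))).
  + by move=> _; apply: analytic0_cst.
  + move=> _; exists (Df j) => //.
    have := @jacobian_partial n f j _ (analytic0_cst n 1).
    by congr jacobian_ideal; apply/funext => z; rewrite mul1r.
  apply/near0_rVP; exists 1 => // w _.
  by rewrite (bigD1 tt) //= big1 ?addr0 ?scale1r // => -[].
- eexists; last reflexivity; apply: doubled_module_second.
    have := @jacobian_partial n f j _ (analytic0_cst n 1).
    by congr jacobian_ideal; apply/funext => z; rewrite mul1r.
  exact: jacobian_partial (analytic0_coord j).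
apply/near0_rV1P; near=> t.
have gEt : euler g t = \sum_(j < n) euler (x j) t * Df j (\row_j x j t).
  by near: t.
have hEt : euler (fun t => f (\row_j y j t)) t =
    \sum_(j < n) euler (y j) t * Df j (\row_j y j t) by near: t.
have ght : g t = f (\row_j y j t) by near: t.
have ghEt : euler g t = euler (fun t => f (\row_j y j t)) t by near: t.
have cEt : g t = c t * euler g t by near: t.
have dEt : forall j, euler (x j) t - euler (y j) t = d j t * (x j t - y j t).
  by near: t.
rewrite big_sumType /= /doubled lE rE -ght !sum_scale_pair.
rewrite -[RHS]/(_ + _, _ + _); congr pair.
  rewrite [X in _ + X]big1 ?addr0 => [|j _]; last by rewrite mulr0.
  rewrite -[LHS]/(g t) cEt gEt mulr_sumr; apply: eq_bigr => j _.
  by rewrite mxE mulrA.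
rewrite cEt ghEt hEt mulr_sumr -big_split /=; apply: eq_bigr => j _.
rewrite !mxE; have /eqP := dEt j; rewrite subr_eq => /eqP ->.
by ring.
Unshelve. all: by end_near. Qed.

End Saturation.

Unset Implicit Arguments.

Theorem proposition2p6 (R : realType) (n : nat) (f : 'rV[Cplx R]_n -> Cplx R)
    (f_analytic : analytic0 f) (f_origin : f 0 = 0) :
  rel_lipschitz_saturation f (jacobian_ideal f) f.
Proof.
exact: (mem_rel_lipschitz_saturation_jacobian (@complex_summable R)).
Qed.
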